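(* Let $\Gamma$ be a finite simple graph and let $G$ be the right-angled Coxeter group with defining graph $\Gamma$. Suppose that $G$ is infinite. Then the geodesic exponential growth rate $\beta(G)$ of $G$ with respect to its standard set of generators $V\Gamma$ is either equal to $1$ or a Perron number.
   Context: The right-angled Coxeter group defined by a simple graph $\Gamma$ with vertex set $V\Gamma$ and edge set $E\Gamma$ is the group with presentation $$G=\langle v\in V\Gamma \mid v^2=1 \text{ for all } v\in V\Gamma,\ [u,v]=1 \text{ if } (u,v)\in E\Gamma\rangle .$$ Its standard generating set is $V\Gamma$. For a group $G$ with finite generating set $S$, let $b_l$ be the number of geodesic paths of length $l$ in the Cayley graph of $G$ with respect to $S$ starting at the identity, where a geodesic path is a path joining two given vertices and having the minimal number of edges. (Equivalently, for the group above with $S=V\Gamma$, $b_l$ is the number of words of length $l$ over $S$ that are of minimal length among all words representing the same group element.) The geodesic exponential growth rate of $G$ with respect to $S$ is $\beta(G)=\beta(G,S)=\limsup_{l\to\infty}\sqrt[l]{b_l}$. A Perron number is a real algebraic integer bigger than $1$ which is strictly greater in absolute value than any of its other Galois conjugates. *)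

(* Defs.v *)
(* Built on MathComp, MathComp-Analysis and real-closed (for R[i]). *)
From HB Require Import structures.
From mathcomp Require Import all_boot all_order all_algebra finmap.
From mathcomp Require Import all_classical all_reals all_analysis.
From mathcomp Require Import complex.

Set Implicit Arguments.
Unset Strict Implicit.
Unset Printing Implicit Defensive.

Import Order.TTheory GRing.Theory Num.Theory.

Local Open Scope classical_set_scope.

Section Presentation.
Variables (X : choiceType) (rels : set (seq (X * bool))).
Implicit Types u v w : seq (X * bool).

(* A letter (x, true) stands for x and (x, false) for x^-1. *)
Inductive pres_eq : seq (X * bool) -> seq (X * bool) -> Prop :=
| pres_refl u : pres_eq u u
| pres_sym u v : pres_eq u v -> pres_eq v u
| pres_trans u v w : pres_eq u v -> pres_eq v w -> pres_eq u w
| pres_cat u u' v v' : pres_eq u u' -> pres_eq v v' ->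
    pres_eq (u ++ v) (u' ++ v')
| pres_cancel x b : pres_eq [:: (x, b); (x, ~~ b)] [::]
| pres_rel r : rels r -> pres_eq r [::].

Definition pres_eqb : rel (seq (X * bool)) := fun u v => `[< pres_eq u v >].

Lemma pres_eqb_refl : reflexive pres_eqb.
Proof. by move=> u; apply/asboolP/pres_refl. Qed.

Lemma pres_eqb_sym : symmetric pres_eqb.
Proof. by move=> u v; apply/asboolP/asboolP; apply: pres_sym. Qed.

Lemma pres_eqb_trans : transitive pres_eqb.
Proof.
by move=> v u w /asboolP uv /asboolP vw; apply/asboolP; apply: pres_trans vw.
Qed.

Canonical pres_equiv :=
  EquivRel pres_eqb pres_eqb_refl pres_eqb_sym pres_eqb_trans.

Local Open Scope quotient_scope.

Definition presented_group := {eq_quot pres_equiv}.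

HB.instance Definition _ := Choice.on presented_group.
HB.instance Definition _ := EqQuotient.on presented_group.

Definition pres_class u : presented_group := \pi_presented_group u.

Lemma pres_classP u v : pres_class u = pres_class v <-> pres_eq u v.
Proof.
split=> [/eqquotP|uv]; first by move/asboolP.
by apply/eqquotP/asboolP.
Qed.

Lemma pres_classK (g : presented_group) : pres_class (repr g) = g.
Proof. exact: reprK. Qed.

Definition winv u := rev [seq (a.1, ~~ a.2) | a <- u].

Lemma winvK : involutive winv.
Proof.
move=> u; rewrite /winv map_rev revK -map_comp map_id_in //.
by case=> x b _ /=; rewrite negbK.
Qed.

Lemma winv_cat u v : winv (u ++ v) = winv v ++ winv u.
Proof. by rewrite /winv map_cat rev_cat. Qed.

Lemma pres_mulV u : pres_eq (u ++ winv u) [::].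
Proof.
elim: u => [|[x b] u IH]; first exact: pres_refl.
rewrite -cat1s winv_cat -catA (catA u).
apply: (pres_trans (v := [:: (x, b)] ++ ([::] ++ [:: (x, ~~ b)]))).
  apply: pres_cat; first exact: pres_refl.
  by apply: pres_cat => //; exact: pres_refl.
exact: pres_cancel.
Qed.

Lemma pres_winv u v : pres_eq u v -> pres_eq (winv u) (winv v).
Proof.
move=> uv; apply: (pres_trans (v := winv u ++ (v ++ winv v))).
  rewrite -{1}[winv u]cats0; apply: pres_cat; first exact: pres_refl.
  exact/pres_sym/pres_mulV.
rewrite catA -[X in pres_eq _ X]cat0s; apply: pres_cat; last exact: pres_refl.
apply: (pres_trans (v := winv u ++ u)).
  by apply: pres_cat; [exact: pres_refl | exact: pres_sym].
by rewrite -{2}[u]winvK; exact: pres_mulV.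
Qed.

Definition pres_one : presented_group := pres_class [::].
Definition pres_mul (g h : presented_group) := pres_class (repr g ++ repr h).
Definition pres_inv (g : presented_group) := pres_class (winv (repr g)).

Lemma pres_repr u : pres_eq (repr (pres_class u)) u.
Proof. by apply/pres_classP; rewrite pres_classK. Qed.

Lemma pres_classM u v : pres_mul (pres_class u) (pres_class v) =
  pres_class (u ++ v).
Proof. by apply/pres_classP/pres_cat; exact: pres_repr. Qed.

Lemma pres_classV u : pres_inv (pres_class u) = pres_class (winv u).
Proof. by apply/pres_classP/pres_winv/pres_repr. Qed.

Lemma pres_mulA : associative pres_mul.
Proof.
move=> f g h; rewrite -(pres_classK f) -(pres_classK g) -(pres_classK h).
by rewrite !pres_classM catA.
Qed.

Lemma pres_mul1 : left_id pres_one pres_mul.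
Proof. by move=> g; rewrite -(pres_classK g) pres_classM. Qed.

Lemma pres_mulr1 : right_id pres_one pres_mul.
Proof. by move=> g; rewrite -(pres_classK g) pres_classM cats0. Qed.

Lemma pres_mulVg : left_inverse pres_one pres_inv pres_mul.
Proof.
move=> g; rewrite -(pres_classK g) pres_classV pres_classM.
by apply/pres_classP; rewrite -{2}[repr g]winvK; exact: pres_mulV.
Qed.

Lemma pres_mulgV : right_inverse pres_one pres_inv pres_mul.
Proof.
move=> g; rewrite -(pres_classK g) pres_classV pres_classM.
exact/pres_classP/pres_mulV.
Qed.

HB.instance Definition _ := isGroup.Build presented_group
  pres_mulA pres_mul1 pres_mulr1 pres_mulVg pres_mulgV.

Definition pres_gen (x : X) : presented_group := pres_class [:: (x, true)].

End Presentation.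

Section Coxeter.
Variables (V : finType) (e : rel V).

Definition racg_rels : set (seq (V * bool)) :=
  [set r | (exists v, r = [:: (v, true); (v, true)]) \/
    (exists u v, e u v /\
       r = [:: (u, false); (v, false); (u, true); (v, true)])].

Definition racg : groupType := presented_group racg_rels.

Definition racg_gens : set racg := range (@pres_gen V racg_rels).

End Coxeter.

Section GeodesicGrowth.
Variables (G : groupType) (S : set G).

(* Adjacency in the Cayley graph, whose edges join g to g * s for s in S. *)
Definition cayley_adj : rel G :=
  fun g h => `[< exists2 s, S s & h = (g * s)%g \/ g = (h * s)%g >].

(* The path with vertices x :: p, which has size p edges. *)
Definition geodesic (x : G) (p : seq G) : Prop :=
  path cayley_adj x p /\
  forall q, path cayley_adj x q -> last x q = last x p -> size p <= size q.

(* The set of paths counted is finite as soon as S is; otherwise fset_set may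
   return the empty set. *)
Definition num_geodesics (l : nat) : nat :=
  #|` fset_set [set p : seq G | size p = l /\ geodesic 1%g p]|.

Local Open Scope ring_scope.

(* limn_sup is the real-valued limsup of a bounded sequence; the sequence below
   is bounded when S is finite, since then b_l <= (2 * #|S|) ^ l. *)
Definition geodesic_growth_rate (R : realType) : R :=
  limn_sup (fun l => (num_geodesics l)%:R `^ (l%:R^-1)).

End GeodesicGrowth.

Section Perron.
Variable R : realType.
Local Open Scope ring_scope.
Local Open Scope complex_scope.

Definition is_min_poly (p : {poly rat}) (z : R[i]) : Prop :=
  [/\ p \is monic, irreducible_poly p & root (map_poly ratr p) z].

Definition galois_conjugate (z w : R[i]) : Prop :=
  exists2 p, is_min_poly p z & root (map_poly ratr p) w.

Definition perron_number (x : R) : Prop :=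
  [/\ integralOver (intr : int -> R) x, 1 < x &
      forall w : R[i], galois_conjugate x%:C w -> w != x%:C -> `|w| < `|x%:C|].

End Perron.

(* Main.v *)
Require Import Defs.
From mathcomp Require Import all_boot all_order all_algebra finmap.
From mathcomp Require Import all_classical all_reals all_analysis.
From mathcomp Require Import complex zify ring lra.

(** Geodesic words are recognised by a finite automaton.  A word is geodesic
    iff no letter is read while it is a right descent of the prefix before it,
    and the set of right descents of a prefix, a clique of Gamma, is enough to
    update itself: reading [v] turns [A] into [{v}] together with the elements
    of [A] adjacent to [v] ([step]).  That words accepted by this automaton are
    geodesic is [size_reduced_le]: the letters act on reduced words, up to
    commutation of adjacent letters, by adding or deleting a last letter, this
    action factors through the group, and so the length of the reduced form of
    a word depends only on the group element.

    Call a clique full if it meets every connected component of the complement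
    graph of Gamma.  Full cliques are closed under the transitions and strongly
    connected ([connect_full]): reading a walk of the complement graph which
    starts at an element of the state and covers a whole component erases that
    component from the state, except for the last vertex of the walk.  On full
    states let [transfer] be the operator which sums a function over the
    successors of a state, and let [f > 0] satisfy [transfer f = beta f].  Then
    [beta] is the growth rate ([geodesic_growth_rate_harmonic]).  It is a lower
    bound because the full states can be reached from the empty one.  It is an
    upper bound because a state which misses some components can be completed to
    a full one by adding one vertex of each missing component: a transition
    inside the components already met commutes with the completion, and each of
    the others decreases the number of missing components, so it can be made
    negligible by giving a large weight to every missing component.

    It remains to find [f] and [beta].  If some vertex has two neighbours [a]
    and [c] in the complement graph, then some full state lies on closed walks
    of length 2 and 3, so the transfer matrix is primitive.  By Perron's theorem
    it has a positive eigenvector ([perron_vector_exists]), and every other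
    eigenvalue is smaller in absolute value than [beta] ([perron_gap]).  As the
    characteristic polynomial has integer coefficients, the conjugates of [beta]
    are among its roots, so [beta] is a Perron number.  Otherwise the complement
    graph is a matching, all full states have the same number of successors, and
    [beta] is that number, with [f] constant.  It is positive because a complete
    graph defines a finite group ([finite_racg_complete]). *)

Set Implicit Arguments.
Unset Strict Implicit.
Unset Printing Implicit Defensive.

Import Order.TTheory GRing.Theory Num.Theory numFieldNormedType.Exports.

Local Open Scope classical_set_scope.

(** * Reduced words up to commutation *)

Section Words.
Variables (V : finType) (e : rel V).
Hypotheses (e_sym : symmetric e) (e_irr : irreflexive e).
Implicit Types (u v x : V) (w s : seq V) (A B : {set V}).

Definition step A v : {set V} := v |: [set u in A | e u v].

(** Words are written with the last letter read at the head, so that appending a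
    letter is [cons].  The result is the set of letters which some sequence of
    commutations brings to the end of the word. *)
Definition descents w : {set V} := foldr (fun v A => step A v) finset.set0 w.

Fixpoint reduced w : bool :=
  if w is v :: w' then (v \notin descents w') && reduced w' else true.

(** Right multiplication by the generator [v], on reduced words. *)
Definition act v w : seq V := if v \in descents w then rem v w else v :: w.

(** By the projection lemma for partially commutative monoids, this is equality
    up to commutation of adjacent letters joined by an edge.  The case [u = v]
    controls the number of occurrences of each letter. *)
Definition trace_eq w w' : Prop :=
  forall u v, ~~ e u v -> seq.filter (pred2 u v) w = seq.filter (pred2 u v) w'.

Lemma in_step A v u : (u \in step A v) = (u == v) || (u \in A) && e u v.
Proof. by rewrite !inE. Qed.

Lemma descents_cons v w : descents (v :: w) = step (descents w) v.
Proof. by []. Qed.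

Lemma trace_eq_sym w w' : trace_eq w w' -> trace_eq w' w.
Proof. by move=> ww' u v uv; rewrite ww'. Qed.

Lemma trace_eq_trans w2 w1 w3 :
  trace_eq w1 w2 -> trace_eq w2 w3 -> trace_eq w1 w3.
Proof. by move=> w12 w23 u v uv; rewrite w12 // w23. Qed.

Lemma trace_eq_cons v w w' : trace_eq w w' -> trace_eq (v :: w) (v :: w').
Proof. by move=> ww' a b ab /=; rewrite ww'. Qed.

Lemma trace_eq_size w w' : trace_eq w w' -> size w = size w'.
Proof.
move=> ww'; apply: perm_size; apply/allP => v _ /=.
have := ww' v v; rewrite e_irr => /(_ isT)/(congr1 size); rewrite !size_filter.
rewrite !(eq_count (a1 := pred2 v v) (a2 := pred1 v)) => [->|u|u] //=;
  by rewrite orbb.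
Qed.

Lemma filter_rem (p : pred V) v w :
  seq.filter p (rem v w) =
  if p v then rem v (seq.filter p w) else seq.filter p w.
Proof.
elim: w => [|x w IH] /=; first by case: ifP.
have [->|xv] := eqVneq x v.
  by case: (p v) => /=; rewrite ?eqxx.
by rewrite /= IH; case: (p x); case: (p v) => //=; rewrite (negbTE xv).
Qed.

Lemma trace_eq_rem v w w' : trace_eq w w' -> trace_eq (rem v w) (rem v w').
Proof. by move=> ww' a b ab; rewrite !filter_rem ww'. Qed.

(** A letter [v] can be brought to the end iff no letter that does not commute
    with it occurs after its last occurrence.  This reading of descents depends
    only on the projections in [trace_eq]. *)
Lemma descentsP v w : reflect
  (forall u, ~~ e u v -> ohead (seq.filter (pred2 u v) w) = Some v)
  (v \in descents w).
Proof.
apply: (iffP idP); elim: w => [|x w IH] /=.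
- by rewrite inE.
- rewrite in_step => /orP[/eqP -> u _|/andP[/IH vw evx] u uv] /=.
    by rewrite eqxx orbT.
  case: ifP => [/orP[/eqP xu|/eqP xv]|_]; last exact: vw.
    by rewrite -xu e_sym evx in uv.
  by rewrite xv.
- by move/(_ v); rewrite e_irr => /(_ isT).
rewrite in_step => vw; have [//|vx /=] := eqVneq v x.
have [evx|nevx] := boolP (e v x); last first.
  have := vw x; rewrite e_sym nevx /= eqxx /= => /(_ isT)[xv].
  by rewrite xv eqxx in vx.
rewrite andbT; apply: IH => u uv; have := vw u uv.
case: ifP => // /orP[/eqP xu|/eqP xv]; last by rewrite xv eqxx in vx.
by rewrite -xu e_sym evx in uv.
Qed.

Lemma trace_eq_descents w w' : trace_eq w w' -> descents w = descents w'.
Proof.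
by move=> ww'; apply/setP => v; apply/descentsP/descentsP => H u uv;
  have := H u uv; rewrite ww'.
Qed.

Lemma trace_eq_act v w w' : trace_eq w w' -> trace_eq (act v w) (act v w').
Proof.
move=> ww'; rewrite /act -(trace_eq_descents ww').
by case: ifP => _; [exact: trace_eq_rem | exact: trace_eq_cons].
Qed.

Lemma trace_eq_cons_rem v w : v \in descents w -> trace_eq (v :: rem v w) w.
Proof.
move=> /descentsP vw a b ab; rewrite /= filter_rem /=.
case vab: ((v == a) || (v == b)) => //; have /orP[/eqP va|/eqP vb] := vab.
  have := vw b; rewrite e_sym va ab => /(_ isT).
  rewrite (eq_filter (a2 := pred2 a b)) => [|c]; last by rewrite /= orbC.
  by case: seq.filter => //= c s [->]; rewrite eqxx.
have := vw a; rewrite vb ab => /(_ isT).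
by case: seq.filter => //= c s [->]; rewrite eqxx.
Qed.

Lemma edge_neq u v : e u v -> (u == v) = false.
Proof. by apply: contraTF => /eqP ->; rewrite e_irr. Qed.

(** Whether [u] is a descent is decided by the letters that do not commute with
    it, and [v] is not one of them. *)
Lemma in_descents_rem u v w : v \in descents w -> e u v ->
  (u \in descents (rem v w)) = (u \in descents w).
Proof.
move=> vw uv; rewrite -(trace_eq_descents (trace_eq_cons_rem vw)).
by rewrite descents_cons in_step uv andbT edge_neq.
Qed.

Lemma in_descents_act u v w : e u v ->
  (u \in descents (act v w)) = (u \in descents w).
Proof.
move=> uv; rewrite /act; case: ifP => [vw|_]; first exact: in_descents_rem.
by rewrite descents_cons in_step uv andbT edge_neq.
Qed.

Lemma reduced_rem v w : v \in descents w -> reduced w ->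
  reduced (rem v w) && (v \notin descents (rem v w)).
Proof.
elim: w => [|x w IH] /=; first by rewrite inE.
rewrite in_step => vw /andP[xw rw].
have [<-|xv] := eqVneq x v; first by rewrite rw xw.
move: vw; rewrite eq_sym (negbTE xv) /= => /andP[vw evx].
have /andP[-> vrw] := IH vw rw.
rewrite in_step eq_sym (negbTE xv) (negbTE vrw) /= !andbT.
by rewrite in_descents_rem // e_sym.
Qed.

Lemma reduced_act v w : reduced w -> reduced (act v w).
Proof.
rewrite /act; case: ifP => [vw|vw rw]; first by case/(reduced_rem vw)/andP.
by rewrite /= vw.
Qed.

Lemma act_act v w : reduced w -> trace_eq (act v (act v w)) w.
Proof.
move=> rw; rewrite {2}/act; case: ifP => vw.
  have /andP[_ /negbTE vrw] := reduced_rem vw rw.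
  by rewrite /act vrw; exact: trace_eq_cons_rem.
by rewrite /act descents_cons in_step eqxx /= eqxx.
Qed.

Lemma rem_rem u v w : rem u (rem v w) = rem v (rem u w).
Proof.
elim: w => //= x w IH.
have [xv|xv] := eqVneq x v; have [xu|xu] := eqVneq x u => //=.
- by rewrite -xv -xu.
- by rewrite xv eqxx.
- by rewrite xu eqxx.
by rewrite (negbTE xu) (negbTE xv) IH.
Qed.

Lemma act_comm u v w : e u v -> trace_eq (act u (act v w)) (act v (act u w)).
Proof.
move=> uv; have vu : e v u by rewrite e_sym.
rewrite {1}/act in_descents_act // {3}/act in_descents_act // /act.
case: ifP => uw; case: ifP => vw //=.
- by rewrite rem_rem.
- by rewrite edge_neq.
- by rewrite edge_neq.
(* a nonadjacent pair does not contain both [u] and [v] *)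
move=> a b ab /=; case: ifP => //; case: ifP => //.
by move=> /orP[]/eqP va /orP[]/eqP ub; move: ab uv vu e_irr;
  rewrite ?va ?ub => /negbTE ab; rewrite ?ab // => + + /(_ _) ->.
Qed.

End Words.

(** * The word problem in a right-angled Coxeter group *)

Section WordProblem.
Variables (V : finType) (e : rel V).
Hypotheses (e_sym : symmetric e) (e_irr : irreflexive e).
Implicit Types (u v : V) (w : seq V) (r : seq (V * bool)).

Local Notation G := (racg e).
Local Notation gen := (@pres_gen V (racg_rels e)).
Local Open Scope group_scope.

Definition act_word r w : seq V := foldl (fun w a => act e a.1 w) w r.

Lemma trace_eq_act_word r w w' :
  trace_eq e w w' -> trace_eq e (act_word r w) (act_word r w').
Proof.
by elim: r w w' => //= a r IH w w' /(trace_eq_act e_sym e_irr a.1)/IH.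
Qed.

Lemma reduced_act_word r w : reduced e w -> reduced e (act_word r w).
Proof. by elim: r w => //= a r IH w /(reduced_act e_sym e_irr a.1)/IH. Qed.

(** The action of words on reduced words respects the defining relations: a
    generator acts as an involution and joined generators commute.  This is what
    separates elements of the group. *)
Lemma act_word_pres r r' : pres_eq (racg_rels e) r r' ->
  forall w, reduced e w -> trace_eq e (act_word r w) (act_word r' w).
Proof.
elim=> {r r'}
  [r|r r' _ IH|r1 r2 r3 _ IH1 _ IH2|r1 r1' r2 r2' _ IH1 _ IH2|v b|r].
- by [].
- by move=> w /IH/trace_eq_sym.
- by move=> w rw; exact: trace_eq_trans (IH1 w rw) (IH2 w rw).
- move=> w rw; rewrite /act_word !foldl_cat -!/(act_word _ _).
  apply: trace_eq_trans (trace_eq_act_word r2 (IH1 w rw)) (IH2 _ _).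
  exact: reduced_act_word.
- by move=> w rw; exact: act_act.
move=> [[v ->] w rw|[u [v [uv ->]]] w rw]; first exact: act_act.
have vu : e v u by rewrite e_sym.
have tact := trace_eq_act e_sym e_irr.
apply: (@trace_eq_trans _ _ (act e v (act e u (act e u (act e v w))))).
  exact: tact _ _ _ (tact _ _ _ (act_comm e_sym e_irr w vu)).
apply: trace_eq_trans (act_act e_sym e_irr v rw); apply: tact.
by apply: act_act => //; exact: reduced_act.
Qed.

Definition word_value w : G := foldr (fun v g => g * gen v) 1 w.

Lemma racg_classM r r' :
  (pres_class _ r : G) * pres_class _ r' = pres_class _ (r ++ r').
Proof. exact: pres_classM. Qed.

Lemma racg_classV r : (pres_class _ r : G)^-1 = pres_class _ (winv r).
Proof. exact: pres_classV. Qed.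

Lemma racg_gen_sq v : gen v * gen v = 1 :> G.
Proof.
by rewrite racg_classM; apply/pres_classP/pres_rel; left; exists v.
Qed.

Lemma racg_gen_inv v : (gen v : G)^-1 = gen v.
Proof. by apply/eqP; rewrite eq_sym -mulg_eq1 racg_gen_sq. Qed.

Lemma racg_gen_comm u v : e u v -> gen u * gen v = gen v * gen u :> G.
Proof.
move=> uv; have : (gen u : G)^-1 * (gen v)^-1 * gen u * gen v = 1.
  rewrite !racg_classV (racg_classM [:: (u, false)] [:: (v, false)]).
  rewrite (racg_classM [:: (u, false); (v, false)] [:: (u, true)]) racg_classM.
  apply/pres_classP/pres_rel; right.
  by exists u, v.
move=> /eqP; rewrite mulg_eq1 !racg_gen_inv => /eqP/(canRL (mulgK _)).
by rewrite racg_gen_inv.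
Qed.

Lemma racg_letter (v : V) b : pres_class _ [:: (v, b)] = gen v :> G.
Proof.
case: b => //; rewrite -racg_gen_inv racg_classV.
by apply/pres_classP/pres_refl.
Qed.

Lemma word_value_rem v w :
  v \in descents e w -> word_value (rem v w) * gen v = word_value w.
Proof.
elim: w => [|x w IH] /=; first by rewrite inE.
rewrite in_step; have [->|xv] := eqVneq x v; first by [].
move=> /= /andP[/IH <- evx].
by rewrite -[LHS]mulgA -[RHS]mulgA (racg_gen_comm evx).
Qed.

Lemma word_value_act v w : word_value (act e v w) = word_value w * gen v.
Proof.
rewrite /act; case: ifP => // vw.
by rewrite -(word_value_rem vw) -mulgA racg_gen_sq mulg1.
Qed.

Lemma word_value_act_word r w :
  word_value (act_word r w) = word_value w * pres_class _ r.
Proof.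
elim: r w => [|[v b] r IH] w /=; first by rewrite mulg1.
rewrite IH word_value_act -mulgA; congr (_ * _).
by rewrite -(racg_letter v b) racg_classM.
Qed.

Definition letters w : seq (V * bool) := [seq (v, true) | v <- rev w].

Lemma racg_class_letters w : pres_class _ (letters w) = word_value w.
Proof.
elim: w => //= v w IH; rewrite -IH racg_classM /letters rev_cons map_rcons.
by rewrite cats1.
Qed.

(** The reduced form of a word, obtained by letting its letters act on the empty
    word. *)
Definition normal w : seq V := foldr (act e) [::] w.

Lemma act_word_letters w : act_word (letters w) [::] = normal w.
Proof.
elim: w => //= v w <-.
by rewrite /letters rev_cons map_rcons /act_word foldl_rcons.
Qed.

Lemma reduced_normal w : reduced e (normal w).
Proof. by elim: w => //= v w; exact: reduced_act. Qed.

Lemma word_value_normal w : word_value (normal w) = word_value w.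
Proof. by elim: w => //= v w IH; rewrite word_value_act IH. Qed.

Lemma normal_id w : reduced e w -> normal w = w.
Proof.
by elim: w => //= v w IH /andP[vw /IH ->]; rewrite /act (negbTE vw).
Qed.

Lemma size_act v w : size (act e v w) <= (size w).+1.
Proof.
rewrite /act; case: ifP => // _; apply: leq_trans (leqnSn _).
exact: (size_subseq (rem_subseq _ _)).
Qed.

(** Each letter lengthens the reduced form by one or shortens it by one, and a
    shortening occurs exactly when the word is not reduced. *)
Lemma size_normal w : size (normal w) <= size w ?= iff reduced e w.
Proof.
split; first by elim: w => //= v w IH; apply: leq_trans (size_act _ _) _.
apply/eqP/idP => [|/normal_id -> //].
elim: w => //= v w IH; rewrite /act; case: ifP => [vw sz|vw [/IH rw]].
  have le_w : size (normal w) <= size w.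
    by elim: (w) => //= a s IHs; apply: leq_trans (size_act _ _) _.
  have := size_subseq (rem_subseq v (normal w)).
  by rewrite sz => /leq_trans/(_ le_w); rewrite ltnn.
by rewrite rw andbT -{1}(normal_id rw) vw.
Qed.

Lemma trace_eq_normal w w' :
  word_value w = word_value w' -> trace_eq e (normal w) (normal w').
Proof.
rewrite -!racg_class_letters => /pres_classP/act_word_pres/(_ [::] isT).
by rewrite !act_word_letters.
Qed.

(** Two words with the same value have reduced forms of the same length; that
    length is [size w] for the reduced word [w] and at most [size w'] for the
    other one. *)
Lemma size_reduced_le w w' :
  reduced e w -> word_value w = word_value w' -> size w <= size w'.
Proof.
move=> rw /trace_eq_normal/(trace_eq_size e_irr).
by rewrite (normal_id rw) => ->; exact: (size_normal w').
Qed.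

Lemma racg_gen_inj : injective gen.
Proof.
move=> u v uv.
have /trace_eq_normal/(_ u u) : word_value [:: u] = word_value [:: v].
  by rewrite /= uv.
rewrite e_irr !normal_id /= ?inE // => /(_ isT); rewrite eqxx /=.
by case: eqP.
Qed.

Lemma word_value_surj g : exists w, reduced e w /\ word_value w = g.
Proof.
exists (act_word (repr g) [::]); split; first exact: reduced_act_word.
by rewrite word_value_act_word mul1g pres_classK.
Qed.

End WordProblem.

(** * Geodesics are reduced words *)

Section CayleyPaths.
Variables (V : finType) (e : rel V).
Hypotheses (e_sym : symmetric e) (e_irr : irreflexive e).
Implicit Types (u v : V) (w : seq V).

Local Notation G := (racg e).
Local Notation gen := (@pres_gen V (racg_rels e)).
Local Notation adj := (cayley_adj (@racg_gens V e)).
Local Open Scope group_scope.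

(** As generators are involutions, the two orientations of an edge of the Cayley
    graph agree. *)
Lemma cayley_adjP (g h : G) : reflect (exists v, h = g * gen v) (adj g h).
Proof.
apply: (iffP (asboolP _)) => [[_ [v _ <-] [->|->]]|[v ->]].
- by exists v.
- by exists v; rewrite -mulgA racg_gen_sq mulg1.
- by exists (gen v); [exists v | left].
Qed.

(** The vertices after the first one of the path from 1 labelled by the word. *)
Fixpoint trail w : seq G :=
  if w is v :: w' then rcons (trail w') (word_value e w) else [::].

Lemma size_trail w : size (trail w) = size w.
Proof. by elim: w => //= v w IH; rewrite size_rcons IH. Qed.

Lemma last_trail w : last 1 (trail w) = word_value e w.
Proof. by case: w => //= v w; rewrite last_rcons. Qed.

Lemma path_trail w : path adj 1 (trail w).
Proof.
elim: w => //= v w IH; rewrite rcons_path IH last_trail.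
by apply/cayley_adjP; exists v.
Qed.

Lemma trail_surj p : path adj 1 p -> exists w, p = trail w.
Proof.
elim/last_ind: p => [|p g IH]; first by exists [::].
rewrite rcons_path => /andP[/IH[w ->]].
rewrite last_trail => /cayley_adjP[v ->].
by exists (v :: w).
Qed.

Lemma trail_inj : injective trail.
Proof.
elim=> [|v w IH] [|v' w'] //=.
- by move=> /(congr1 size); rewrite size_rcons.
- by move=> /(congr1 size); rewrite size_rcons.
by move=> /rcons_inj[/IH -> /mulgI/(racg_gen_inj e_sym e_irr) ->].
Qed.

Lemma geodesic_trail w : geodesic (@racg_gens V e) 1 (trail w) <-> reduced e w.
Proof.
split=> [[_ geo]|rw].
  have := geo (trail (normal e w)) (path_trail _).
  rewrite !last_trail word_value_normal // !size_trail => /(_ erefl).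
  by rewrite -(geq_leqif (size_normal e w)).
split; first exact: path_trail.
move=> q /trail_surj[w' ->]; rewrite !last_trail !size_trail => ww'.
exact: (size_reduced_le e_sym e_irr rw (esym ww')).
Qed.

Fixpoint reduced_words l : seq (seq V) :=
  if l is l'.+1 then
    [seq v :: w | w <- reduced_words l', v <- enum (~: descents e w)]
  else [:: [::]].

Lemma mem_reduced_words l w :
  (w \in reduced_words l) = (size w == l) && reduced e w.
Proof.
elim: l w => [|l IH] [|v w] //=.
  by apply/allpairsPdep => -[? [? [_ _]]].
rewrite eqSS andbCA -IH; apply/allpairsPdep/andP => [[w' [v' []]]|[vw wl]].
  by move=> wl; rewrite mem_enum inE => vw [-> ->].
by exists w, v; split=> //; rewrite mem_enum inE.
Qed.

Lemma uniq_reduced_words l : uniq (reduced_words l).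
Proof.
elim: l => //= l IH; apply: allpairs_uniq_dep => // [w _|].
  exact: enum_uniq.
by move=> [w v] [w' v'] _ _ /= [-> ->].
Qed.

Lemma num_geodesicsE l :
  num_geodesics (@racg_gens V e) l = size (reduced_words l).
Proof.
rewrite /num_geodesics.
have -> : [set p | size p = l /\ geodesic (@racg_gens V e) 1 p] =
    [set` [fset p in map trail (reduced_words l)]%fset].
  apply/seteqP; split=> p /=; rewrite inE.
    move=> [sp geo]; have [w pw] := trail_surj geo.1.
    move: sp geo; rewrite pw size_trail => sw /geodesic_trail rw.
    by apply: map_f; rewrite mem_reduced_words sw eqxx.
  move=> /mapP[w]; rewrite mem_reduced_words => /andP[/eqP sw rw] ->.
  by rewrite size_trail; split=> //; apply/geodesic_trail.
by rewrite set_fsetK card_fseq undup_id ?size_map // map_inj_uniq //;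
  [exact: uniq_reduced_words | exact: trail_inj].
Qed.

(** In a complete graph all letters of a reduced word are descents, so a reduced
    word has no repetition and there are finitely many of them. *)
Lemma finite_racg_complete :
  (forall u v, u != v -> e u v) -> finite_set [set: racg e].
Proof.
move=> e_all; pose N := #|V|.
have desc_mem w u : reduced e w -> (u \in descents e w) = (u \in w).
  elim: w => [|v w IH] /=; first by rewrite inE.
  move=> /andP[_ rw]; rewrite in_step in_cons IH //; have [//|uv] := eqVneq u v.
  by rewrite e_all // andbT.
have uniq_red w : reduced e w -> uniq w.
  by elim: w => //= v w IH /andP[vw rw]; rewrite IH // -desc_mem // vw.
pose L := flatten [seq reduced_words l | l <- iota 0 N.+1].
apply: (@sub_finite_set _ _ (word_value e @` [set` [fset w in L]%fset])).
  move=> g _; have [w [rw <-]] := word_value_surj e_sym e_irr g.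
  have wL : w \in L.
    apply/flatten_mapP; exists (size w).
      by rewrite mem_iota /= add0n ltnS -(card_uniqP (uniq_red w rw)) max_card.
    by rewrite mem_reduced_words eqxx.
  by exists w => //=; apply/imfsetP; exists w.
apply: finite_image; exact: finite_fset.
Qed.

End CayleyPaths.

(** * The automaton of descent sets *)

Section DescentAutomaton.
Variables (V : finType) (e : rel V).
Hypotheses (e_sym : symmetric e) (e_irr : irreflexive e).
Implicit Types (u v t x : V) (A B : {set V}).

(** Adjacency in the complement graph. *)
Definition nonadj : rel V := fun u v => (u != v) && ~~ e u v.

Definition clique A := [forall u in A, forall v in A, (u != v) ==> e u v].

(** The recurrent states of the automaton, see [connect_full]. *)
Definition full A := clique A && [forall v, exists u in A, connect nonadj v u].

Definition move : rel {set V} :=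
  fun A B => [exists v, (v \notin A) && (step e A v == B)].

Lemma nonadj_sym : symmetric nonadj.
Proof. by move=> u v; rewrite /nonadj eq_sym e_sym. Qed.

Lemma nonadj_csym : connect_sym nonadj.
Proof. exact/sym_connect_sym/nonadj_sym. Qed.

Lemma cliqueP A :
  reflect (forall u v, u \in A -> v \in A -> u != v -> e u v) (clique A).
Proof.
apply: (iffP forall_inP) => [cA u v /cA/forall_inP uA /uA/implyP //|cA u uA].
by apply/forall_inP => v vA; apply/implyP; exact: cA.
Qed.

Lemma fullP A :
  reflect (clique A /\ forall v, exists2 u, u \in A & connect nonadj v u)
          (full A).
Proof.
by apply: (iffP andP) => -[cA fA]; split=> //; [move=> v|apply/forallP => v];
  [exact/exists_inP/(forallP fA) | exact/exists_inP].
Qed.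

Lemma move_step A v : v \notin A -> move A (step e A v).
Proof. by move=> vA; apply/existsP; exists v; rewrite vA eqxx. Qed.

Lemma clique_step A v : clique A -> clique (step e A v).
Proof.
move=> /cliqueP cA; apply/cliqueP => x y; rewrite !in_step.
case/orP => [/eqP ->|/andP[xA xv]]; case/orP => [/eqP ->|/andP[yA yv]] //.
- by rewrite eqxx.
- by rewrite e_sym.
- exact: cA.
Qed.

Lemma connect_nonadj1 u v : ~~ e u v -> connect nonadj u v.
Proof.
move=> uv; have [->|neq] := eqVneq u v; first exact: connect0.
by apply: connect1; rewrite /nonadj neq.
Qed.

Lemma full_step A v : full A -> full (step e A v).
Proof.
move=> /fullP[cA fA]; apply/fullP; split=> [|x]; first exact: clique_step.
have [u uA xu] := fA x; have [uv|uv] := boolP (e u v).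
  by exists u => //; rewrite in_step uA uv orbT.
exists v; first by rewrite in_step eqxx.
exact/(connect_trans xu)/connect_nonadj1.
Qed.

Lemma full_move A B : move A B -> full A -> full B.
Proof. by move=> /existsP[v /andP[_ /eqP <-]]; exact: full_step. Qed.

Lemma full_connect A B : connect move A B -> full A -> full B.
Proof.
case/connectP=> p; elim: p A => [|C p IH] A /=; first by move=> _ ->.
by move=> /andP[moveAC /IH/[apply] CB /(full_move moveAC)].
Qed.

(** Each letter of a walk of the complement graph is erased by the next one, and
    cannot have been a descent when it is read since the letter before it still
    is one.  What survives is the last letter and the part of [A] that commutes
    with the whole walk. *)
Lemma connect_walk A p0 p : clique A -> p0 \in A -> path nonadj p0 p ->
  p != [::] -> connect move A (last p0 p |: [set u in A | all (e u) p]).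
Proof.
elim: p p0 A => //= x p IH p0 A cA p0A /andP[p0x xp] _.
have xA : x \notin A.
  apply/negP => xA; case/andP: p0x => neq /negP; apply.
  exact: (cliqueP _ cA).
apply: (connect_trans (connect1 (move_step xA))).
have [->|pn] := eqVneq p [::].
  rewrite /= (_ : _ |: _ = step e A x) ?connect0 //.
  by apply/setP => u; rewrite in_step !inE andbT.
have := IH x (step e A x) (clique_step x cA) _ xp pn.
rewrite in_step eqxx => /(_ isT); congr (connect _ _ (_ |: _)).
apply/setP => u; rewrite inE [in RHS]inE in_step.
have [->|_] := eqVneq u x; last by rewrite andbA.
case: p xp pn {IH} => //= y p /andP[/andP[_ /negbTE ->]].
by rewrite ?e_irr ?andbF.
Qed.

Lemma covering_walk p0 t : connect nonadj p0 t ->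
  exists p, [/\ path nonadj p0 p, last p0 p = t &
                forall u, connect nonadj p0 u -> u \in p0 :: p].
Proof.
move=> p0t.
have [p [p_path p_cover]] : exists p, path nonadj p0 p /\
    forall u, u \in enum V -> connect nonadj p0 u -> u \in p0 :: p.
  elim: (enum V) => [|v s [p [p_path p_cover]]]; first by exists [::].
  have [p0v|p0v] := boolP (connect nonadj p0 v); last first.
    exists p; split=> // u; rewrite inE => /orP[/eqP ->|/p_cover //].
    by rewrite (negbTE p0v).
  have /connectP[q q_path vq] : connect nonadj (last p0 p) v.
    apply: connect_trans p0v; rewrite nonadj_csym.
    by apply: (path_connect p_path); exact: mem_last.
  exists (p ++ q); split=> [|u]; first by rewrite cat_path p_path.
  rewrite -cat_cons mem_cat inE => /orP[/eqP -> _|/p_cover/[apply] ->] //.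
  have := mem_last (last p0 p) q; rewrite -vq inE.
  by case/orP=> [/eqP ->|->]; rewrite ?mem_last ?orbT.
have /connectP[q q_path tq] : connect nonadj (last p0 p) t.
  apply: connect_trans p0t; rewrite nonadj_csym.
  by apply: (path_connect p_path); exact: mem_last.
exists (p ++ q); split; rewrite ?cat_path ?p_path ?last_cat //.
by move=> u /p_cover; rewrite mem_enum -cat_cons mem_cat => ->.
Qed.

(** Read a walk from [p0] to [t] that covers the component of [p0]: an element
    of that component which is in [A] is either [p0], erased by the first letter
    of the walk, or a letter of the walk, hence not adjacent to itself. *)
Lemma connect_reset A p0 t : clique A -> p0 \in A -> connect nonadj p0 t ->
  connect move A (t |: [set u in A | ~~ connect nonadj p0 u]).
Proof.
move=> cA p0A /covering_walk[p [p_path p_last p_cover]].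
have [p0p|pn] := eqVneq p [::].
  move: p_last p_cover; rewrite p0p /= => <- p_cover.
  rewrite [X in connect _ _ X](_ : _ = A) ?connect0 //.
  apply/setP => u; rewrite !inE.
  have [->|up0] := eqVneq u p0; first by rewrite p0A.
  rewrite /= -[RHS]andbT; congr (_ && _); apply: contraNT up0.
  by rewrite negbK => /p_cover; rewrite inE.
have := connect_walk cA p0A p_path pn; rewrite p_last.
congr (connect _ _ (_ |: _)); apply/setP => u; rewrite !inE; congr (_ && _).
apply/allP/idP => [u_p|p0u x xp].
  apply/negP => /p_cover; rewrite inE.
  move=> /orP[/eqP up0|/u_p]; last by rewrite e_irr.
  case: p p_path pn u_p {p_last p_cover} => //= x p /andP[/andP[_ p0x] _] _.
  by move/(_ x (mem_head _ _)); rewrite up0 (negbTE p0x).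
apply: contraNT p0u => ux.
apply: (@connect_trans _ _ x).
  by apply: (path_connect p_path); rewrite inE xp orbT.
by rewrite nonadj_csym; exact: connect_nonadj1.
Qed.

Lemma connect_subset A B : A \subset B -> clique B -> connect move A B.
Proof.
move=> AB /cliqueP cB; have [n] := ubnP #|B :\: A|.
elim: n => // n IH in A AB *; rewrite ltnS => cardBA.
have [BA|/subsetPn[t tB tA]] := boolP (B \subset A).
  by have -> : A = B by apply/eqP; rewrite finset.eqEsubset AB.
have stepE : step e A t = t |: A.
  apply/setP => u; rewrite in_step inE inE; have [//|ut /=] := eqVneq u t.
  have [uA|//] := boolP (u \in A).
  by rewrite cB // (fintype.subsetP AB).
apply: (connect_trans (connect1 (move_step tA))); rewrite stepE; apply: IH.
  by rewrite finset.subUset finset.sub1set tB.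
apply: leq_trans cardBA; apply: proper_card; apply/properP; split.
  by apply: finset.setDS; exact: finset.subsetUr.
by exists t; rewrite !inE ?tB ?tA ?eqxx.
Qed.

(** The components in which [A] is not contained in [B] are reset one after the
    other to a vertex of [B], after which the missing letters of [B] can be
    read in any order. *)
Lemma connect_full A B : full A -> full B -> connect move A B.
Proof.
move=> fA /fullP[cB fB].
suff [C [moveAC CB]] : exists C, connect move A C /\ C \subset B.
  exact: connect_trans moveAC (connect_subset CB cB).
have [n] := ubnP #|A :\: B|.
elim: n => // n IH in A fA *; rewrite ltnS => cardAB.
have [AB|/subsetPn[u uA uB]] := boolP (A \subset B).
  by exists A; rewrite connect0.
have [t tB ut] := fB u; have /fullP[cA _] := fA.
have := connect_reset cA uA ut; set C := _ |: _ => moveAC.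
have [||D [CD DB]] := IH C;
  last by exists D; split=> //; exact: connect_trans CD.
  exact: full_connect moveAC fA.
apply: leq_trans cardAB; apply: proper_card; apply/properP; split.
  apply/fintype.subsetP => x; rewrite !inE => /andP[xB].
  by case/orP=> [/eqP xt|/andP[-> _]]; [rewrite xt tB in xB | rewrite xB].
exists u; first by rewrite !inE uA uB.
by rewrite !inE uB connect0 andbF orbF; apply: contraNneq uB => ->.
Qed.

(** One vertex of each component of the complement graph. *)
Definition transversal_roots : {set V} := [set v | fingraph.root nonadj v == v].

Lemma clique_transversal A :
  {in A &, forall u v, connect nonadj u v -> u = v} -> clique A.
Proof.
move=> tA; apply/cliqueP => u v uA vA; apply: contraNT => uv.
by apply/eqP; apply: tA => //; exact: connect_nonadj1.
Qed.

Lemma full_transversal_roots : full transversal_roots.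
Proof.
apply/fullP; split=> [|v].
  apply: clique_transversal => u v; rewrite !inE => /eqP ur /eqP vr uv.
  by rewrite -ur -vr; apply/eqP; rewrite (root_connect nonadj_csym).
exists (fingraph.root nonadj v); last exact: connect_root.
by rewrite inE root_root //; exact: nonadj_csym.
Qed.

(** With [R] a choice of vertices for the components other than that of [b], the
    words [ab] and [acb] both lead from [{b} + R] back to itself, whether or not
    [a] and [c] are adjacent. *)
Lemma full_cycles a b c : nonadj b a -> nonadj b c -> a != c ->
  exists A A1 A2, [/\ full A, move A A1, move A1 A, move A1 A2 & move A2 A] /\
                  A != A2.
Proof.
move=> ba bc ac; pose R := [set u in transversal_roots | ~~ connect nonadj b u].
have conn_R x u : connect nonadj b x -> u \in R -> e u x.
  rewrite inE => bx /andP[_]; apply: contraR => ux.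
  by apply: (connect_trans bx); rewrite nonadj_csym connect_nonadj1.
have fbR : full (b |: R).
  have [u uT bu] := (fullP _ full_transversal_roots).2 b.
  have cT := (fullP _ full_transversal_roots).1.
  apply: (full_connect _ full_transversal_roots).
  have := connect_reset cT uT (_ : connect nonadj u b).
  rewrite nonadj_csym => /(_ bu); congr (connect _ _ (_ |: _)).
  by apply/setP => x; rewrite !inE (same_connect nonadj_csym bu).
clearbody R.
have notin_R x : connect nonadj b x -> x \notin R.
  by move=> bx; apply/negP => /(conn_R x x bx); rewrite e_irr.
have bab : connect nonadj b b by exact: connect0.
have baa := connect1 ba; have bcc := connect1 bc.
have ab : e a b = false by move: ba; rewrite nonadj_sym => /andP[_ /negbTE].
have cb : e c b = false by move: bc; rewrite nonadj_sym => /andP[_ /negbTE].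
have nba : (b == a) = false by case/andP: ba => /negbTE.
have nbc : (b == c) = false by case/andP: bc => /negbTE.
have eba : e b a = false by case/andP: ba => _ /negbTE.
pose Rac := c |: [set u in a |: R | e u c].
exists (b |: R), (a |: R), Rac; split; last first.
  apply/eqP => /setP/(_ b).
  by rewrite !inE eqxx nba nbc (negbTE (notin_R _ _)).
split.
- exact: fbR.
- rewrite [X in move _ X](_ : _ = step e (b |: R) a); last first.
    apply/setP => u; rewrite in_step !inE; case: eqVneq => //= _.
    have [->|ub] /= := eqVneq u b; first by rewrite eba (negbTE (notin_R _ _)).
    by have [uR|//] := boolP (u \in R); rewrite (conn_R a).
  by apply: move_step; rewrite !inE eq_sym nba (negbTE (notin_R _ _)).
- rewrite [X in move _ X](_ : _ = step e (a |: R) b); last first.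
    apply/setP => u; rewrite in_step !inE; case: eqVneq => //= _.
    have [->|ua] /= := eqVneq u a; first by rewrite ab (negbTE (notin_R _ _)).
    by have [uR|//] := boolP (u \in R); rewrite (conn_R b).
  by apply: move_step; rewrite !inE nba (negbTE (notin_R _ _)).
- apply: move_step; rewrite !inE eq_sym (negbTE ac) (negbTE (notin_R _ _)) //.
rewrite [X in move _ X](_ : _ = step e Rac b); last first.
  apply/setP => u; rewrite in_step !inE; case: eqVneq => //= _.
  have [->|uc] /= := eqVneq u c; first by rewrite cb (negbTE (notin_R _ _)).
  have [->|ua] /= := eqVneq u a.
    by rewrite ab andbF (negbTE (notin_R _ _)).
  by have [uR|//] := boolP (u \in R); rewrite (conn_R b) ?(conn_R c).
by apply: move_step; rewrite !inE nba nbc (negbTE (notin_R _ _)).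
Qed.

Section Matching.
Hypothesis nonadj_uniq : forall b a c, nonadj b a -> nonadj b c -> a = c.

(** Here a component of the complement graph has at most two vertices, and
    reading a letter replaces the vertex present in its component by the other
    one. *)
Lemma card_step A v : full A -> v \notin A -> #|step e A v| = #|A|.
Proof.
move=> /fullP[_ fA] vA; have [u uA /connectP[[|x p] /= vp lastp]] := fA v.
  by rewrite -lastp uA in vA.
have{vp} [vx xp] := andP vp.
have xv : nonadj x v by rewrite nonadj_sym.
have stay q : forall y, y \in pred2 v x -> path nonadj y q ->
    last y q \in pred2 v x.
  elim: q => //= z q IH y yvx /andP[yz zq]; apply: IH zq.
  case/orP: yvx yz => /eqP ->.
    by move/(nonadj_uniq vx) => <-; rewrite inE eqxx orbT.
  by move/(nonadj_uniq xv) => <-; rewrite inE eqxx.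
have := stay p x _ xp; rewrite -lastp !inE eqxx orbT => /(_ isT).
move=> /orP[/eqP uv|/eqP ux]; first by rewrite -uv uA in vA.
rewrite ux in uA.
have -> : step e A v = v |: (A :\ x).
  apply/setP => y; rewrite in_step !inE andbC; congr (_ || _).
  have [yA|] := boolP (y \in A); rewrite ?andbF // !andbT.
  have [->|yx] := eqVneq y x; first by apply/negbTE; case/andP: xv.
  apply: contraNT yx => yv; apply/eqP; apply: nonadj_uniq vx.
  by rewrite nonadj_sym /nonadj yv andbT; apply: contraNneq vA => <-.
by rewrite cardsU1 !inE (negbTE vA) andbF (cardsD1 x A) uA.
Qed.

Lemma card_full A B : full A -> full B -> #|A| = #|B|.
Proof.
move=> fA /(connect_full fA)/connectP[p]; elim: p A fA => [|C p IH] A fA /=.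
  by move=> _ ->.
move=> /andP[moveAC Cp] lastp; rewrite -(IH C) ?(full_move moveAC) //.
by case/existsP: moveAC => v /andP[vA /eqP <-]; rewrite card_step.
Qed.

End Matching.
End DescentAutomaton.

(** * Perron vectors of primitive matrices *)

Section PerronVector.
Local Open Scope ring_scope.
Variables (R : realType) (n : nat).
Implicit Types (A P : 'M[R]_n) (x : 'rV[R]_n).

Lemma rV_mulmx_entry_continuous A j :
  continuous (fun x : 'rV[R]_n => (x *m A) ord0 j).
Proof.
under eq_fun do rewrite mxE.
apply: continuous_big => [|i _]; first exact: add_continuous.
move=> x; apply: continuousM; first exact: coord_continuous.
exact: cst_continuous.
Qed.

Lemma rV_sum_continuous : continuous (fun x : 'rV[R]_n => \sum_i x ord0 i).
Proof.
apply: continuous_big => [|i _]; first exact: add_continuous.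
by move=> x; apply: coord_continuous.
Qed.

Lemma mulmx_gt0 P x j : (forall i j, 0 < P i j) -> (forall i, 0 <= x ord0 i) ->
  x != 0 -> 0 < (x *m P) ord0 j.
Proof.
move=> P_gt0 x_ge0 x_neq0; rewrite mxE lt_def sumr_ge0 ?andbT; last first.
  by move=> i _; rewrite mulr_ge0 // ltW.
apply: contraNneq x_neq0 => /eqP.
rewrite psumr_eq0 => [/allP x0|i _]; last first.
  by rewrite mulr_ge0 // ltW.
apply/eqP/rowP => i; rewrite mxE; apply/eqP.
have := x0 i (mem_index_enum i).
by rewrite /= mulf_eq0 (gt_eqF (P_gt0 _ _)) orbF.
Qed.

(** Pairs [(x, l)] with [l x <= x A] and [x] in the standard simplex.  The bound
    [B] on [l] makes the set compact. *)
Definition subeigenpairs A (B : R) : set ('rV[R]_n * R) :=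
  ([set x : 'rV[R]_n | forall i, x ord0 i \in `[0, 1]] `*` `[0, B]%classic) `&`
  [set p : 'rV[R]_n * R | \sum_i p.1 ord0 i = 1 /\
           forall i, p.2 * p.1 ord0 i <= (p.1 *m A) ord0 i].

Lemma compact_subeigenpairs A B : compact (subeigenpairs A B).
Proof.
have cK : compact
    ([set x : 'rV[R]_n | forall i, x ord0 i \in `[0, 1]] `*` `[0, B]%classic).
  apply: compact_setX; last exact: segment_compact.
  apply: (@rV_compact R n (fun=> `[0, 1]%classic)) => i.
  exact: segment_compact.
rewrite /subeigenpairs; apply: compact_closedI => //.
have -> : [set p : 'rV[R]_n * R | \sum_i p.1 ord0 i = 1 /\
      forall i, p.2 * p.1 ord0 i <= (p.1 *m A) ord0 i] =
    ((fun p : 'rV[R]_n * R => \sum_i p.1 ord0 i) @^-1` [set y | y = 1]) `&`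
    \bigcap_(i in setT) ((fun p : 'rV[R]_n * R =>
       (p.1 *m A) ord0 i - p.2 * p.1 ord0 i) @^-1` [set y | 0 <= y]).
  apply/seteqP; split=> p /= [p1 p2]; split=> // i.
    by move=> _ /=; rewrite subr_ge0.
  by have := p2 i I; rewrite /= subr_ge0.
have cfst (g : 'rV[R]_n -> R) : continuous g ->
    continuous (fun p : 'rV[R]_n * R => g p.1).
  move=> cg p; apply: (@continuous_comp _ _ _ fst g p); last exact: cg.
  exact: cvg_fst.
apply: closedI.
  apply: preimage_closed; last exact: closed_eq.
  by move=> p _; exact: (cfst _ rV_sum_continuous).
apply: closed_bigI => i _; apply: preimage_closed; last exact: closed_ge.
move=> p _; have cfstA : continuous (fun p : 'rV[R]_n * R => (p.1 *m A) ord0 i).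
  exact: (cfst _ (@rV_mulmx_entry_continuous A i)).
have cprod : continuous (fun p : 'rV[R]_n * R => p.2 * p.1 ord0 i).
  move=> q; apply: continuousM; first exact: cvg_snd.
  by apply: (cfst (fun x => x ord0 i)); exact: coord_continuous.
exact: (@continuousB R R^o _ _ _ _ (cfstA p) (cprod p)).
Qed.

Lemma exists_scale_le (I : finType) (f g : I -> R) :
  (forall i, 0 < f i) -> (forall i, 0 <= g i) ->
  exists2 d : R, 0 < d & forall i, d * g i <= f i.
Proof.
move=> f_gt0 g_ge0; pose s := 1 + \sum_i g i / f i.
have s_ge0 i : 0 <= g i / f i by rewrite divr_ge0 // ltW.
have s_gt0 : 0 < s by rewrite ltr_pwDl // sumr_ge0.
exists s^-1 => [|i]; first by rewrite invr_gt0.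
rewrite mulrC ler_pdivrMr // mulrC -ler_pdivrMr // /s (bigD1 i) //=.
by rewrite addrCA lerDl addr_ge0 // sumr_ge0.
Qed.

(** Take a pair with [l x <= x A] and [l] maximal, which exists by compactness.
    If equality failed, multiplying the defect [x A - l x] by the positive
    matrix [A ^+ m] would make it positive everywhere, and [l] could be
    increased.  So [x A ^+ m] is a positive eigenvector. *)
Lemma perron_vector_exists A m : (0 < n)%N ->
  (forall i j, 0 <= A i j) -> (forall i j, 0 < (A ^+ m) i j) ->
  exists (beta : R) (x : 'rV[R]_n),
    (forall i, 0 < x ord0 i) /\ x *m A = beta *: x.
Proof.
move=> n_gt0 A_ge0 P_gt0; pose B := \sum_i \sum_j A i j.
have le_eig (x : 'rV[R]_n) (l : R) : (forall i, 0 <= x ord0 i <= 1) ->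
    \sum_i x ord0 i = 1 -> (forall i, l * x ord0 i <= (x *m A) ord0 i) ->
    l <= B.
  move=> x01 x1 lx; rewrite -[l]mulr1 -x1 mulr_sumr.
  apply: (le_trans (ler_sum _ (fun i _ => lx i))).
  under eq_bigr => i _ do rewrite mxE.
  rewrite exchange_big /= ler_sum // => i _.
  by apply: ler_sum => j _; have /andP[? ?] := x01 i; rewrite ler_piMl.
have B_ge0 : 0 <= B by rewrite sumr_ge0 // => i _; rewrite sumr_ge0.
have n_neq0 : n%:R != 0 :> R by rewrite pnatr_eq0 -lt0n.
have K0 : subeigenpairs A B !=set0.
  exists (const_mx n%:R^-1, 0); split; [split=> /= [i|]|split=> [|i]] => /=.
  - by rewrite mxE in_itv /= invr_ge0 ler0n invf_le1 ?ler1n ?ltr0n.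
  - by rewrite in_itv /= lexx.
  - under eq_bigr do rewrite mxE.
    by rewrite sumr_const card_ord -[LHS]mulr_natr mulVf.
  - rewrite mul0r mxE sumr_ge0 // => j _.
    by rewrite mxE mulr_ge0 // invr_ge0 ler0n.
have [|[x l]] := compact_EVT_max K0 (@compact_subeigenpairs A B) (f := snd).
  by apply: continuous_subspaceT => p; exact: cvg_snd.
rewrite inE => -[[/= x01 l0B] [/= x1 lx]] lmax.
have x_ge0 i : 0 <= x ord0 i by have := x01 i; rewrite in_itv => /andP[].
have x_neq0 : x != 0.
  apply: contra_eq_neq x1 => ->; under eq_bigr do rewrite mxE.
  by rewrite big1 // eq_sym oner_neq0.
pose y := x *m A ^+ m.
have y_gt0 i : 0 < y ord0 i by exact: mulmx_gt0.
have PA : A *m A ^+ m = A ^+ m *m A by rewrite !mulmxE -exprS exprSr.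
exists l, y; split=> //; rewrite /y -mulmxA -PA mulmxA.
suff -> : x *m A = l *: x by rewrite scalemxAl.
apply/eqP; rewrite -subr_eq0; apply/negP => /negP u_neq0.
set u := x *m A - l *: x in u_neq0.
have u_ge0 i : 0 <= u ord0 i 
  by rewrite mxE [X in _ + X]mxE [X in _ - X]mxE subr_ge0.
have [d d_gt0 dle] := exists_scale_le
  (fun i => mulmx_gt0 i P_gt0 u_ge0 u_neq0) (fun i => ltW (y_gt0 i)).
(* [y] satisfies the inequality with [l + d] instead of [l] *)
have yA i : (l + d) * y ord0 i <= (y *m A) ord0 i.
  have -> : y *m A = u *m A ^+ m + l *: y.
    by rewrite mulmxBl -scalemxAl subrK -!mulmxA PA.
  by rewrite mulrDl [leLHS]addrC [leRHS]mxE [X in _ <= _ + X]mxE lerD2r.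
have S_gt0 : 0 < \sum_i y ord0 i.
  rewrite (bigD1 (Ordinal n_gt0)) //= ltr_pwDl // sumr_ge0 // => i _.
  exact: ltW.
set S := \sum_i _ in S_gt0.
have yS1 : \sum_i (S^-1 *: y) ord0 i = 1.
  by under eq_bigr do rewrite mxE; rewrite -mulr_sumr mulVf ?gt_eqF.
have yS01 i : 0 <= (S^-1 *: y) ord0 i <= 1.
  have ge0 j : 0 <= (S^-1 *: y) ord0 j.
    by rewrite mxE mulr_ge0 ?invr_ge0 // ltW.
  by rewrite ge0 -yS1 (bigD1 i) //= lerDl sumr_ge0.
have yAS i : (l + d) * (S^-1 *: y) ord0 i <= (S^-1 *: y *m A) ord0 i.
  rewrite -scalemxAl mxE [leRHS]mxE mulrCA ler_wpM2l // invr_ge0.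
  exact: ltW.
suff /(lmax (_, _)) /= : (S^-1 *: y, l + d) \in subeigenpairs A B.
  by rewrite gerDl leNgt d_gt0.
rewrite inE; split; [split=> /= [i|]|split] => //.
  by rewrite in_itv /=.
rewrite in_itv /= (le_eig (S^-1 *: y)) // andbT addr_ge0 ?(ltW d_gt0) //.
by move: l0B; rewrite in_itv => /andP[].
Qed.

End PerronVector.

Section PerronNumber.
Local Open Scope ring_scope.
Local Open Scope complex_scope.
Import Normc.

Lemma eigenvector_expmx (F : fieldType) n (A : 'M[F]_n) (v : 'rV[F]_n) a m :
  v *m A = a *: v -> v *m A ^+ m = a ^+ m *: v.
Proof.
move=> vA; elim: m => [|m IH]; first by rewrite !expr0 mulmx1 scale1r.
by rewrite exprS -mulmxE mulmxA vA -scalemxAl IH scalerA exprS.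
Qed.

Lemma map_mx_exp (R S : nzRingType) (f : {rmorphism R -> S}) n (A : 'M[R]_n) m :
  map_mx f (A ^+ m) = map_mx f A ^+ m.
Proof.
elim: m => [|m IH]; first by rewrite !expr0 map_mx1.
by rewrite !exprS -!mulmxE map_mxM IH.
Qed.

(** Let [z] be an eigenvector for [w], and let [c] be the maximum, attained at
    [j], of the ratios [|z_i| / x_i].  The triangle inequality for the entry [j]
    of [z A ^+ m] and the bound [|z| <= c x] give
    [|w| ^+ m |z_j| <= c beta ^+ m x_j = beta ^+ m |z_j|].  If [beta <= |w|],
    equality holds throughout: as all entries of [A ^+ m] are positive, [|z|] is
    proportional to [x], and all [z_i] have the same argument.  Hence [z] is
    proportional to [x]. *)
Lemma perron_gap (R : realType) n (A : 'M[R]_n) m (beta : R) (x : 'rV[R]_n)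
    (w : R[i]) (z : 'rV[R[i]]_n) :
  (forall i j, 0 < (A ^+ m) i j) -> (forall i, 0 < x ord0 i) ->
  x *m A = beta *: x -> 0 <= beta -> z != 0 ->
  z *m map_mx (real_complex R) A = w *: z -> beta <= normc w -> w = beta%:C.
Proof.
move=> P_gt0 x_gt0 xA beta_ge0 z_neq0 zA beta_le.
have [i0 _] : exists2 i0, true & z ord0 i0 != 0.
  apply/exists_inP; apply: contraR z_neq0.
  rewrite negb_exists_in => /forall_inP z0.
  by apply/eqP/rowP => i; rewrite mxE; apply/eqP; rewrite -[_ == _]negbK z0.
pose u i := normc (z ord0 i).
have u_ge0 i : 0 <= u i by rewrite /u; case: (z _ _) => a b; exact: sqrtr_ge0.
have uE i : `|z ord0 i| = (u i)%:C by [].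
set j := [arg max_(i > i0) (u i / x ord0 i)]%O.
have jmax i : u i <= u j / x ord0 j * x ord0 i.
  rewrite -ler_pdivrMr // /j; case: arg_maxP => // k _; exact.
move=> zi0_neq0; set P := A ^+ m in P_gt0.
have xP : x *m P = beta ^+ m *: x by exact: eigenvector_expmx.
have zP : z *m map_mx (real_complex R) P = w ^+ m *: z.
  by rewrite /P map_mx_exp; exact: eigenvector_expmx.
have sumE : \sum_i u j / x ord0 j * x ord0 i * P i j = beta ^+ m * u j.
  under eq_bigr do rewrite -mulrA.
  have := congr1 (fun v : 'rV_n => v ord0 j) xP; rewrite mxE => xPj.
  by rewrite -mulr_sumr xPj mxE mulrCA divfK // gt_eqF.
have zPE : \sum_i z ord0 i * (P i j)%:C = w ^+ m * z ord0 j.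
  have /rowP/(_ j) := zP; rewrite !mxE => <-.
  by apply: eq_bigr => i _; rewrite !mxE.
have normF i : `|z ord0 i * (P i j)%:C| = (u i * P i j)%:C.
  by rewrite normrM uE ger0_norm ?lecR ?(ltW (P_gt0 _ _)) // rmorphM.
have le1 : \sum_i u i * P i j <= \sum_i u j / x ord0 j * x ord0 i * P i j.
  by apply: ler_sum => i _; rewrite ler_pM2r.
have le2 : beta ^+ m * u j <= normc w ^+ m * u j.
  by rewrite ler_wpM2r // lerXn2r // nnegrE (le_trans beta_ge0).
have normS : `|\sum_i z ord0 i * (P i j)%:C| = (normc w ^+ m * u j)%:C.
  by rewrite zPE normrM normrX uE rmorphM rmorphXn.
have le3 : normc w ^+ m * u j <= \sum_i u i * P i j.
  rewrite -lecR -normS rmorph_sum /=; apply: le_trans (ler_norm_sum _ _ _) _.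
  by rewrite ler_sum // => i _; rewrite normF.
have eq1 : \sum_i u i * P i j = \sum_i u j / x ord0 j * x ord0 i * P i j.
  by apply/le_anti; rewrite le1 sumE (le_trans le2).
have uxE i : u i = u j / x ord0 j * x ord0 i.
  have /eqP := eq1; rewrite -subr_eq0 -opprB oppr_eq0 -sumrB.
  rewrite psumr_eq0 => [|k _]; last by rewrite subr_ge0 ler_pM2r.
  move/allP/(_ i (mem_index_enum i)); rewrite /= -mulrBl mulf_eq0.
  by rewrite (gt_eqF (P_gt0 _ _)) orbF subr_eq0 => /eqP <-.
have [t _ tE] : {t : R[i] | `|t| == 1 &
    forall i, true -> z ord0 i * (P i j)%:C = `|z ord0 i * (P i j)%:C| * t}.
  apply: normC_sum_eq; rewrite normS; under [RHS]eq_bigr do rewrite normF.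
  rewrite -rmorph_sum; congr _%:C; apply/le_anti; rewrite le3 /=.
  by rewrite eq1 sumE.
have zE : z = ((u j / x ord0 j)%:C * t) *: map_mx (real_complex R) x.
  apply/rowP => i; rewrite !mxE.
  have P_neq0 : (P i j)%:C != 0 :> R[i] by rewrite fmorph_eq0 gt_eqF.
  apply: (mulIf P_neq0); rewrite tE // normF uxE !rmorphM /=; ring.
have : z *m map_mx (real_complex R) A = beta%:C *: z.
  by rewrite zE -scalemxAl -map_mxM xA map_mxZ !scalerA mulrC.
rewrite zA => /rowP/(_ i0); rewrite !mxE; exact: mulIf.
Qed.

(** The minimal polynomial divides every rational polynomial that vanishes at
    [z], being irreducible and not coprime to it. *)
Lemma galois_conjugate_root (R : realType) (q : {poly rat}) (z w : R[i]) :
  root (map_poly ratr q) z -> galois_conjugate z w -> root (map_poly ratr q) w.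
Proof.
move=> qz [p [_ p_irr pz] pw].
have [pq|npq] := boolP (p %| q)%R.
  by apply: root_dvdp pw; rewrite dvdp_map.
have : coprimep (map_poly ratr p) (map_poly (ratr : rat -> R[i]) q).
  by rewrite coprimep_map irreducible_poly_coprime.
by move=> /coprimep_root/(_ pz); rewrite -rootE qz.
Qed.

Lemma perron_number_eigenvalue (R : realType) n (A : 'M[int]_n) m (beta : R)
    (x : 'rV[R]_n) : (0 < n)%N ->
  (forall i j, 0 < (A ^+ m) i j) -> (forall i, 0 < x ord0 i) ->
  x *m map_mx intr A = beta *: x -> 1 < beta -> perron_number beta.
Proof.
move=> n_gt0 P_gt0 x_gt0 xA beta_gt1.
have x_neq0 : x != 0.
  apply: contraTneq (x_gt0 (Ordinal n_gt0)) => ->.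
  by rewrite mxE ltxx.
have rootA (K : fieldType) (v : 'rV[K]_n) a : v != 0 ->
    v *m map_mx intr A = a *: v -> root (map_poly intr (char_poly A)) a.
  move=> v_neq0 vA; rewrite map_char_poly -eigenvalue_root_char.
  by apply/eigenvalueP; exists v.
split=> [|//|w wconj w_neq].
  exists (char_poly A); first exact: char_poly_monic.
  exact: rootA x_neq0 xA.
have qE (K : numFieldType) :
    map_poly ratr (map_poly (intr : int -> rat) (char_poly A)) =
    map_poly (intr : int -> K) (char_poly A).
  by rewrite -map_poly_comp; apply: eq_map_poly => a /=; rewrite ratr_int.
have cA : map_mx (real_complex R) (map_mx intr A) = map_mx intr A.
  by apply/matrixP => i j; rewrite !mxE rmorph_int.
have /(galois_conjugate_root)/(_ wconj) :
    root (map_poly ratr (map_poly intr (char_poly A))) beta%:C.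
  rewrite qE; apply: (rootA _ (map_mx (real_complex R) x)).
    by rewrite map_mx_eq0.
  by rewrite -cA -map_mxM xA map_mxZ.
rewrite qE map_char_poly -eigenvalue_root_char => /eigenvalueP[z zA z_neq0].
rewrite (ger0_norm (x := beta%:C)) ?lecR ?(ltW (lt_trans ltr01 beta_gt1)) //.
have -> : `|w| = (normc w)%:C by [].
rewrite ltcR ltNge; apply: contra w_neq => le_w; apply/eqP.
apply: (@perron_gap R n (map_mx intr A) m beta x w z) => //.
- by move=> i j; rewrite -map_mx_exp mxE ltr0z.
- exact: ltW (lt_trans ltr01 beta_gt1).
- by rewrite cA.
Qed.

Lemma perron_number_nat (R : realType) k :
  (1 < k)%N -> perron_number (k%:R : R).
Proof.
move=> k_gt1; split=> [||w wconj].
- exact: integral_nat.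
- by rewrite ltr1n.
have : root (map_poly ratr ('X - k%:R%:P)) (k%:R%:C : R[i]).
  by rewrite map_polyXsubC root_XsubC !rmorph_nat.
move=> /galois_conjugate_root/(_ wconj).
by rewrite map_polyXsubC root_XsubC !rmorph_nat => ->.
Qed.

End PerronNumber.

(** * The transfer operator on recurrent states *)

Section Primitive.
Local Open Scope ring_scope.
Variables (n : nat) (M : 'M[int]_n).
Hypothesis M_ge0 : forall i j, 0 <= M i j.

Lemma expmx_ge0 k i j : 0 <= (M ^+ k) i j.
Proof.
elim: k i j => [|k IH] i j; first by rewrite expr0 mxE; case: eqP.
by rewrite exprS -mulmxE mxE sumr_ge0 // => l _; rewrite mulr_ge0.
Qed.

Lemma expmxD_gt0 k l i j h : 0 < (M ^+ k) i j -> 0 < (M ^+ l) j h ->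
  0 < (M ^+ (k + l)) i h.
Proof.
move=> ij jh; rewrite exprD -mulmxE mxE (bigD1 j) //= ltr_pwDl ?mulr_gt0 //.
by rewrite sumr_ge0 // => a _; rewrite mulr_ge0 // expmx_ge0.
Qed.

Lemma connect_expmx_gt0 i j : connect (fun i j => 0 < M i j) i j ->
  exists k, 0 < (M ^+ k) i j.
Proof.
case/connectP=> p; elim: p i => [|h p IH] i /=.
  by move=> _ ->; exists 0%N; rewrite expr0 mxE eqxx.
move=> /andP[ih /IH/[apply] -[k hj]]; exists (1 + k)%N.
by apply: expmxD_gt0 hj; rewrite expr1.
Qed.

(** Closed walks of lengths 2 and 3 at [s] give closed walks of every length at
    least 2, which can be used to pad walks through [s] to a common length. *)
Lemma primitive_expmx s :
  (forall i j, connect (fun i j => 0 < M i j) i j) ->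
  0 < (M ^+ 2) s s -> 0 < (M ^+ 3) s s ->
  exists m, forall i j, 0 < (M ^+ m) i j.
Proof.
move=> conn s2 s3.
have sk k : 0 < (M ^+ k.+2) s s.
  have [m] := ubnP k; elim: m k => // m IH [|[|k]] // km.
  by rewrite -addn2; apply: (expmxD_gt0 (IH k _) s2); lia.
have /fin_all_exists[d ds] i := connect_expmx_gt0 (conn i s).
have /fin_all_exists[d' ds'] j := connect_expmx_gt0 (conn s j).
exists (\sum_i d i + \sum_j d' j + 2)%N => i j.
rewrite (bigD1 i) //= [X in (_ + X + 2)%N](bigD1 j) //=.
set a := (\sum_(_ | _) _)%N; set b := (\sum_(_ | _) _)%N.
have -> : (d i + a + (d' j + b) + 2 = d i + ((a + b).+2 + d' j))%N by lia.
exact: expmxD_gt0 (ds i) (expmxD_gt0 (sk _) (ds' j)).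
Qed.

End Primitive.

Section Transfer.
Local Open Scope ring_scope.
Variables (V : finType) (e : rel V).
Hypotheses (e_sym : symmetric e) (e_irr : irreflexive e).
Variable R : realType.
Implicit Types (f : {set V} -> R) (A B : {set V}).

Definition transfer f A : R := \sum_(v | v \notin A) f (step e A v).

Definition harmonic (beta : R) f : Prop :=
  (forall A, full e A -> 0 < f A) /\
  (forall A, full e A -> transfer f A = beta * f A).

Definition full_state : finType := {A : {set V} | full e A}.
Local Notation T := full_state.

Definition state (i : 'I_#|T|) : {set V} := val (enum_val i : T).

(** Transposed, so that the row vectors for which eigenvectors are defined are
    functions on the states. *)
Definition transfer_mx : 'M[int]_#|T| := \matrix_(i, j)
  #|[set v | (v \notin state j) & (step e (state j) v == state i)]|%:Z.

Lemma full_state_of i : full e (state i).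
Proof. exact: valP. Qed.

Lemma state_inj : injective state.
Proof. by move=> i j /val_inj/enum_val_inj. Qed.

Lemma state_surj A : full e A -> {i | state i = A}.
Proof.
move=> fA; exists (enum_rank (exist _ A fA : T)).
by rewrite /state enum_rankK.
Qed.

Lemma transfer_mx_ge0 i j : 0 <= transfer_mx i j.
Proof. by rewrite mxE. Qed.

Lemma transfer_mx_gt0 i j :
  (0 < transfer_mx i j) = move e (state j) (state i).
Proof.
rewrite mxE ltz_nat card_gt0; apply/set0Pn/existsP => -[v];
  by [rewrite inE; exists v | move=> ?; exists v; rewrite inE].
Qed.

Lemma transfer_mx_connect i j : connect (fun i j => 0 < transfer_mx i j) i j.
Proof.
have /connectP[p] :=
  connect_full e_sym e_irr (full_state_of j) (full_state_of i).
elim: p j => [|B p IH] j /= => [_ /state_inj -> //|].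
move=> /andP[jB Bp] lastp.
have [k kB] := state_surj (full_move e_sym jB (full_state_of j)).
apply: (@connect_trans _ _ k); first by apply: IH; rewrite kB.
by apply: connect1; rewrite transfer_mx_gt0 kB.
Qed.

Definition state_fun (x : 'rV[R]_#|T|) A : R :=
  \sum_(i | state i == A) x ord0 i.

Lemma state_funE (x : 'rV[R]_#|T|) i : state_fun x (state i) = x ord0 i.
Proof.
by rewrite /state_fun (big_pred1 i) // => j; rewrite (inj_eq state_inj).
Qed.

Lemma transfer_state_fun (x : 'rV[R]_#|T|) j :
  transfer (state_fun x) (state j) = (x *m map_mx intr transfer_mx) ord0 j.
Proof.
rewrite mxE /transfer /state_fun (exchange_big_dep predT) //=.
apply: eq_bigr => i _; rewrite !mxE -pmulrn -sum1_card natr_sum mulr_sumr.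
under [RHS]eq_bigl do rewrite inE.
by apply: eq_big => [v|v _]; rewrite ?mulr1 // eq_sym.
Qed.

Lemma harmonic_state_fun (beta : R) (x : 'rV[R]_#|T|) :
  (forall i, 0 < x ord0 i) -> x *m map_mx intr transfer_mx = beta *: x ->
  harmonic beta (state_fun x).
Proof.
move=> x_gt0 xM; split=> A /state_surj[i <-]; rewrite ?state_funE //.
by rewrite transfer_state_fun xM mxE.
Qed.

Lemma card_full_state_gt0 : (0 < #|T|)%N.
Proof.
have [i _] := state_surj (full_transversal_roots e_sym).
exact: leq_ltn_trans (ltn_ord i).
Qed.

Lemma harmonic_move beta f A B : harmonic beta f -> full e A -> move e A B ->
  f B <= beta * f A.
Proof.
move=> [f_gt0 fE] fA /existsP[v /andP[vA /eqP <-]].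
rewrite -fE // /transfer (bigD1 v) //= lerDl sumr_ge0 // => u /andP[uA _].
by apply/ltW/f_gt0; exact: full_step.
Qed.

Lemma harmonic_move2 beta f A B C : harmonic beta f -> full e A ->
  move e A B -> move e A C -> B != C -> f B + f C <= beta * f A.
Proof.
move=> [f_gt0 fE] fA /existsP[v /andP[vA /eqP <-]].
move=> /existsP[u /andP[uA /eqP <-]] vu.
rewrite -fE // /transfer (bigD1 v) //= (bigD1 u) /=.
  rewrite addrA lerDl sumr_ge0 // => x /andP[/andP[xA _] _].
  by apply/ltW/f_gt0; exact: full_step.
by rewrite uA; apply: contraNneq vu => ->.
Qed.

(** The closed walks of [full_cycles] make the transfer matrix primitive.  They
    also give [beta > 1]: [A1] is a successor of [A] and has the two successors
    [A] and [A2], so [beta ^+ 2 * f A >= beta * f A1 >= f A + f A2 > f A]. *)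
Lemma perron_harmonic b a c : nonadj e b a -> nonadj e b c -> a != c ->
  exists2 beta : R, perron_number beta & exists f, harmonic beta f.
Proof.
move=> ba bc ac.
have [A [A1 [A2 [[fA AA1 A1A A1A2 A2A] A_neq]]]] :=
  full_cycles e_sym e_irr ba bc ac.
have fA1 := full_move e_sym AA1 fA; have fA2 := full_move e_sym A1A2 fA1.
have [i iA] := state_surj fA; have [i1 iA1] := state_surj fA1.
have [i2 iA2] := state_surj fA2.
pose M := transfer_mx.
have M1 k l : move e (state k) (state l) -> 0 < (M ^+ 1) l k.
  by rewrite expr1 transfer_mx_gt0.
have M_ge0 := transfer_mx_ge0.
have i_2 : 0 < (M ^+ (1 + 1)) i i.
  by apply: (@expmxD_gt0 _ _ M_ge0 _ _ _ i1); apply: M1; rewrite iA iA1.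
have i_3 : 0 < (M ^+ (1 + (1 + 1))) i i.
  apply: (@expmxD_gt0 _ _ M_ge0 _ _ _ i2); first by apply: M1; rewrite iA iA2.
  by apply: (@expmxD_gt0 _ _ M_ge0 _ _ _ i1); apply: M1; rewrite ?iA ?iA1 ?iA2.
have [m M_gt0] := primitive_expmx M_ge0 transfer_mx_connect i_2 i_3.
have MR_ge0 j k : 0 <= (map_mx intr M : 'M[R]_#|T|) j k by rewrite mxE ler0z.
have MR_gt0 j k : 0 < (map_mx intr M ^+ m : 'M[R]_#|T|) j k.
  by rewrite -map_mx_exp mxE ltr0z.
have [beta [x [x_gt0 xM]]] :=
  perron_vector_exists card_full_state_gt0 MR_ge0 MR_gt0.
have hx := harmonic_state_fun x_gt0 xM.
exists beta; last by exists (state_fun x).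
apply: (perron_number_eigenvalue card_full_state_gt0 M_gt0 x_gt0 xM).
set f := state_fun x in hx; have [f_gt0 _] := hx.
have beta_gt0 : 0 < beta.
  rewrite -(pmulr_lgt0 _ (f_gt0 A fA)).
  by rewrite (lt_le_trans _ (harmonic_move hx fA AA1)) ?f_gt0.
have : f A < beta ^+ 2 * f A.
  apply: lt_le_trans (_ : f A + f A2 <= _); first by rewrite ltrDl f_gt0.
  apply: le_trans (harmonic_move2 hx fA1 A1A A1A2 A_neq) _.
  by rewrite expr2 -mulrA ler_pM2l // harmonic_move.
by rewrite ltr_pMl ?f_gt0 // expr_gt1 // ltW.
Qed.

Lemma harmonic_matching :
  (forall b a c, nonadj e b a -> nonadj e b c -> a = c) ->
  harmonic #|~: transversal_roots e|%:R (fun=> 1).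
Proof.
move=> nonadj_uniq; split=> // A fA.
rewrite mulr1 /transfer sumr_const; congr _%:R.
rewrite -[RHS](addKn #|transversal_roots e|) cardsC.
rewrite (card_full e_sym e_irr nonadj_uniq (full_transversal_roots e_sym) fA).
by rewrite -(cardC (mem A)) addKn.
Qed.

End Transfer.

(** * Exponential growth of the number of geodesics *)

Section RootLimit.
Local Open Scope ring_scope.
Variable R : realType.
Implicit Types (b : nat -> R) (beta : R).

Lemma eventually_expr_le (q c : R) : 0 <= q < 1 -> 0 < c ->
  \forall l \near \oo, q ^+ l <= c.
Proof.
move=> /andP[q_ge0 q_lt1] c_gt0.
have /cvgrPdist_le/(_ c c_gt0) : q ^+ l @[l --> \oo] --> 0.
  by apply: cvg_expr; rewrite ger0_norm.
by apply: filterS => l; rewrite sub0r normrN ger0_norm // exprn_ge0.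
Qed.

Lemma powR_root_expr (x : R) l : 0 <= x -> (0 < l)%N ->
  (x ^+ l) `^ (l%:R^-1) = x.
Proof.
move=> x_ge0 l_gt0; rewrite -powR_mulrn // -powRrM mulfV ?powRr1 //.
by rewrite pnatr_eq0 -lt0n.
Qed.

(** Constant factors do not matter, because [q ^+ l] tends to 0 for [q < 1]
    and so absorbs them. *)
Lemma limn_sup_root b beta : (forall l, 0 <= b l) -> 0 < beta ->
  (exists2 c : R, 0 < c & exists k, forall l, c * beta ^+ l <= b (l + k)%N) ->
  (forall eps : R, 0 < eps ->
     exists2 C : R, 0 < C & forall l, b l <= C * (beta + eps) ^+ l) ->
  limn_sup (fun l => b l `^ (l%:R^-1)) = beta.
Proof.
move=> b_ge0 beta_gt0 [c c_gt0 [k lower]] upper.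
suff : (b l `^ (l%:R^-1)) @[l --> \oo] --> beta by move/cvg_limn_inf_sup => [].
apply/cvgrPdist_le => eps eps_gt0.
have near_upper : \forall l \near \oo, b l `^ (l%:R^-1) <= beta + eps.
  have [C C_gt0 leC] := upper (eps / 2) (divr_gt0 eps_gt0 (ltr0Sn _ _)).
  have s_gt0 : 0 < beta + eps by exact: addr_gt0.
  have q01 : 0 <= (beta + eps / 2) / (beta + eps) < 1.
    rewrite divr_ge0 ?ltW ?addr_gt0 ?divr_gt0 // ltr_pdivrMr // mul1r ltrD2l.
    lra.
  have Ci_gt0 : 0 < C^-1 by rewrite invr_gt0.
  near=> l; have l_gt0 : (0 < l)%N by near: l; exact: nbhs_infty_gt.
  have q_le : ((beta + eps / 2) / (beta + eps)) ^+ l <= C^-1.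
    by near: l; exact: eventually_expr_le.
  rewrite -[leRHS](powR_root_expr (ltW s_gt0) l_gt0).
  apply: ge0_ler_powR;
    rewrite ?invr_ge0 ?nnegrE ?exprn_ge0 ?ler0n ?(ltW s_gt0) //.
  apply: le_trans (leC l) _; move: q_le.
  by rewrite expr_div_n ler_pdivrMr ?exprn_gt0 // ler_pdivlMl.
have near_lower : \forall l \near \oo, beta - eps <= b l `^ (l%:R^-1).
  have [beta_le|lt_eps] := leP beta eps.
    near=> l; apply: le_trans (powR_ge0 _ _); lra.
  have q01 : 0 <= (beta - eps) / beta < 1.
    rewrite divr_ge0 ?subr_ge0 ?(ltW lt_eps) ?(ltW beta_gt0) //.
    by rewrite ltr_pdivrMr // mul1r gtrBl.
  have c'_gt0 : 0 < c / beta ^+ k by rewrite divr_gt0 ?exprn_gt0.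
  near=> l; have l_gt0 : (0 < l)%N by near: l; exact: nbhs_infty_gt.
  have kl : (k <= l)%N by near: l; exact: nbhs_infty_ge.
  have q_le : ((beta - eps) / beta) ^+ l <= c / beta ^+ k.
    by near: l; exact: eventually_expr_le.
  have be_ge0 : 0 <= beta - eps by rewrite subr_ge0 ltW.
  rewrite -[leLHS](powR_root_expr _ l_gt0) //.
  apply: ge0_ler_powR; rewrite ?invr_ge0 ?nnegrE ?exprn_ge0 ?ler0n //.
  rewrite -(subnK kl); apply: le_trans (lower _); rewrite (subnK kl).
  move: q_le; rewrite expr_div_n ler_pdivrMr ?exprn_gt0 // => /le_trans; apply.
  rewrite -{1}(subnK kl) exprD [_ * beta ^+ k]mulrC mulrA divfK //.
  by rewrite expf_neq0 // gt_eqF.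
near=> l; rewrite ler_distl lerBlDr -[X in _ && X]lerBlDr; apply/andP; split.
  by near: l.
by near: l.
Unshelve. all: by end_near. Qed.
End RootLimit.

Section GeodesicCount.
Local Open Scope ring_scope.
Variables (V : finType) (e : rel V).
Hypotheses (e_sym : symmetric e) (e_irr : irreflexive e).
Variable R : realType.
Implicit Types (f : {set V} -> R) (A B : {set V}) (w : seq V).

(** Weights on the final states turn the recursion on the length of words into
    the iteration of [transfer]; the weight 1 counts geodesics. *)
Definition weighted_count l f : R :=
  \sum_(w <- reduced_words e l) f (descents e w).

Lemma weighted_countS l f :
  weighted_count l.+1 f = weighted_count l (transfer e f).
Proof.
rewrite /weighted_count /= big_allpairs_dep; apply: eq_bigr => w _.
by rewrite big_enum /=; apply: eq_bigl => v; rewrite inE.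
Qed.

Lemma weighted_count1 l :
  weighted_count l (fun=> 1) = (size (reduced_words e l))%:R.
Proof. by rewrite /weighted_count big_const_seq count_predT iter_addr_0. Qed.

Lemma clique_descents w : clique e (descents e w).
Proof.
elim: w => [|v w IH]; last exact: clique_step.
by apply/cliqueP => u v; rewrite inE.
Qed.

Lemma le_weighted_count l f g : (forall A, clique e A -> f A <= g A) ->
  weighted_count l f <= weighted_count l g.
Proof. by move=> fg; apply: ler_sum => w _; exact/fg/clique_descents. Qed.

Lemma weighted_countZ l a f :
  weighted_count l (fun A => a * f A) = a * weighted_count l f.
Proof. by rewrite /weighted_count mulr_sumr. Qed.

Lemma weighted_count_le a f l :
  0 <= a -> (forall A, clique e A -> transfer e f A <= a * f A) ->
  weighted_count l f <= a ^+ l * weighted_count 0 f.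
Proof.
move=> a_ge0 fle; elim: l => [|l IH]; first by rewrite mul1r.
rewrite weighted_countS; apply: le_trans (le_weighted_count _ fle) _.
by rewrite weighted_countZ exprS -mulrA ler_wpM2l.
Qed.

Lemma weighted_count_ge a f k l :
  0 <= a -> (forall A, clique e A -> a * f A <= transfer e f A) ->
  a ^+ l * weighted_count k f <= weighted_count (l + k) f.
Proof.
move=> a_ge0 fle; elim: l => [|l IH]; first by rewrite mul1r.
rewrite addSn weighted_countS; apply: le_trans (le_weighted_count _ fle).
by rewrite weighted_countZ exprS -mulrA ler_wpM2l.
Qed.

Lemma reduced_word_connect w A :
  reduced e w -> connect (move e) (descents e w) A ->
  exists2 w', reduced e w' & descents e w' = A.
Proof.
move=> rw /connectP[p]; elim: p w rw => [|B p IH] w rw /=.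
  by move=> _ ->; exists w.
move=> /andP[/existsP[v /andP[vw /eqP <-]]]; apply: (IH (v :: w)).
by rewrite /= vw.
Qed.

(** Extended by 0 outside the full states, [f] satisfies
    [beta * f <= transfer f] everywhere, and it is bounded by a constant. *)
Lemma geodesic_count_lower beta f : 0 < beta -> harmonic e beta f ->
  exists2 c : R, 0 < c & exists k, forall l,
    c * beta ^+ l <= (size (reduced_words e (l + k)))%:R.
Proof.
move=> beta_gt0 [f_gt0 fE]; pose g A := if full e A then f A else 0.
have g_ge0 A : 0 <= g A by rewrite /g; case: ifP => // /f_gt0/ltW.
have gE A : beta * g A <= transfer e g A.
  rewrite {1}/g; case: ifP => [fA|_]; last by rewrite mulr0 sumr_ge0.
  rewrite -fE // ler_sum // => v _; rewrite /g full_step //.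
have [w rw wE] : exists2 w, reduced e w & descents e w = transversal_roots e.
  apply: (@reduced_word_connect [::]) => //.
  have /andP[cT _] := full_transversal_roots e_sym.
  by apply: connect_subset => //; exact: finset.sub0set.
pose s := 1 + \sum_A g A.
have s_gt0 : 0 < s by rewrite ltr_pwDl // sumr_ge0.
have g_le A : s^-1 * g A <= 1.
  rewrite mulrC ler_pdivrMr // mul1r /s (bigD1 A) //= addrCA lerDl.
  by rewrite addr_ge0 // sumr_ge0.
pose k := size w; have gk : 0 < weighted_count k g.
  rewrite /weighted_count (big_rem w) /=; last first.
    by rewrite mem_reduced_words eqxx.
  rewrite ltr_pwDl ?sumr_ge0 // /g wE full_transversal_roots // f_gt0 //.
  exact: full_transversal_roots.
exists (s^-1 * weighted_count k g); first by rewrite mulr_gt0 ?invr_gt0.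
exists k => l; rewrite -weighted_count1 -mulrA [_ * beta ^+ l]mulrC.
apply: (@le_trans _ _ (weighted_count (l + k) (fun A => s^-1 * g A))).
  rewrite weighted_countZ ler_wpM2l ?invr_ge0 ?(ltW s_gt0) //.
  by apply: weighted_count_ge => //; exact: ltW.
by apply: le_weighted_count => A _.
Qed.

Definition meets A v := [exists u in A, connect (nonadj e) v u].

(** Representatives of the components of the complement graph that [A] does not
    meet. *)
Definition missing A : {set V} := [set v in transversal_roots e | ~~ meets A v].

Lemma meets_connect A u v : connect (nonadj e) u v -> meets A u = meets A v.
Proof.
move=> uv; apply: eq_existsb => x; congr (_ && _).
exact: same_connect (nonadj_csym e_sym) _ _ uv _.
Qed.

Lemma meets_step A v x :
  meets (step e A v) x = meets A x || connect (nonadj e) x v.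
Proof.
apply/exists_inP/orP => [[u]|[/exists_inP[u uA xu]|xv]].
- rewrite in_step => /orP[/eqP -> xv|/andP[uA _] xu]; [by right | left].
  by apply/exists_inP; exists u.
- have [uv|uv] := boolP (e u v).
    by exists u; rewrite // in_step uA uv orbT.
  exists v; first by rewrite in_step eqxx.
  exact/(connect_trans xu)/connect_nonadj1.
- by exists v; rewrite // in_step eqxx.
Qed.

Lemma full_completion A : clique e A -> full e (A :|: missing A).
Proof.
move=> /cliqueP cA.
have mis u v : u \in missing A -> v \in A -> e v u.
  rewrite inE => /andP[_ nu] vA; apply: contraR nu => vu.
  by apply/exists_inP; exists v; rewrite // (nonadj_csym e_sym) connect_nonadj1.
apply/(fullP _ _); split=> [|v].
  apply/cliqueP => u v; rewrite !finset.in_setU => /orP[uA|um] /orP[vA|vm] uv.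
  - exact: cA.
  - exact: mis.
  - by rewrite e_sym mis.
  apply: contraNT uv => uv; move: um vm.
  rewrite !inE => /andP[/eqP <- _] /andP[/eqP <- _].
  by rewrite root_connect ?connect_nonadj1 //; exact: nonadj_csym.
have [/exists_inP[u uA vu]|nv] := boolP (meets A v).
  by exists u; rewrite // finset.in_setU uA.
exists (fingraph.root (nonadj e) v); last exact: connect_root.
rewrite !inE (root_root (nonadj_csym e_sym)) eqxx /=.
by rewrite -(meets_connect _ (connect_root _ _)) nv orbT.
Qed.

Lemma missing_step_meets A v : meets A v -> missing (step e A v) = missing A.
Proof.
move=> Av; apply/setP => x; rewrite !finset.in_set meets_step.
have [xv|_] := boolP (connect _ x v); last by rewrite orbF.
by rewrite (meets_connect _ xv) Av.
Qed.

Lemma missing_step_proper A v :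
  ~~ meets A v -> missing (step e A v) \proper missing A.
Proof.
move=> Av; apply/properP; split.
  apply/fintype.subsetP => x; rewrite !finset.in_set meets_step negb_or.
  by move=> /andP[-> /andP[->]].
have vr := connect_root (nonadj e) v.
exists (fingraph.root (nonadj e) v); rewrite !finset.in_set root_root ?eqxx //=.
- by rewrite -(meets_connect _ vr).
- exact: nonadj_csym.
- by rewrite meets_step (nonadj_csym e_sym) vr orbT.
- exact: nonadj_csym.
Qed.

(** The vertices added to [A] lie in components not met by [A], so they commute
    with a letter [v] whose component is met. *)
Lemma step_completion A v : meets A v ->
  step e (A :|: missing A) v = step e A v :|: missing (step e A v).
Proof.
move=> Av; rewrite missing_step_meets //; apply/setP => u.
rewrite [LHS]in_step [in RHS]finset.in_setU [u \in step e A v]in_step.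
rewrite finset.in_setU andb_orl orbA; congr (_ || _).
have [um|//] := boolP (u \in missing A); apply/idP.
move: um; rewrite inE => /andP[_]; apply: contraR; rewrite andTb => uv.
by rewrite (meets_connect _ (connect_nonadj1 uv)).
Qed.

(** The function [y A = M ^+ #|missing A| * f (A :|: missing A)] satisfies
    [transfer y <= (beta + eps) y] for [M] large.  The letters whose component
    is met by [A] contribute at most [beta * y A], since they act on the
    completion as on [A]; each of the others loses a factor [M] at least. *)
Lemma geodesic_count_upper beta f : 0 < beta -> harmonic e beta f ->
  forall eps : R, 0 < eps -> exists2 C : R, 0 < C &
    forall l, (size (reduced_words e l))%:R <= C * (beta + eps) ^+ l.
Proof.
move=> beta_gt0 [f_gt0 fE] eps eps_gt0.
(* [d] and [X] bound [f] from below and above on the full states *)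
have [d d_gt0 d_le] : exists2 d : R, 0 < d & forall A, full e A -> d <= f A.
  have [||d d_gt0 d_le] := @exists_scale_le R {set V}
      (fun A => if full e A then f A else 1) (fun=> 1).
  - by move=> A; case: ifP => // /f_gt0.
  - by [].
  by exists d => // A fA; have := d_le A; rewrite fA mulr1.
pose X := \sum_(A | full e A) f A.
have X_ge0 : 0 <= X by apply: sumr_ge0 => A /f_gt0/ltW.
have le_X A : full e A -> f A <= X.
  move=> fA; rewrite /X (bigD1 A) //= lerDl sumr_ge0 // => B /andP[fB _].
  exact/ltW/f_gt0.
pose M := 1 + #|V|%:R * X / (eps * d).
have M_ge1 : 1 <= M by rewrite lerDl divr_ge0 ?mulr_ge0 // ltW.
have M_gt0 : 0 < M by exact: lt_le_trans M_ge1.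
(* the contribution of all letters that lose a factor [M] is at most [eps y] *)
have leM : #|V|%:R * X <= eps * d * M.
  have ed_gt0 : 0 < eps * d by exact: mulr_gt0.
  by rewrite /M mulrDr mulr1 [_ * (_ / _)]mulrC divfK ?gt_eqF // lerDr ltW.
pose y A := M ^+ #|missing A| * f (A :|: missing A).
have y_ge A : clique e A -> d <= y A.
  move=> cA; rewrite -[d]mul1r ler_pM ?(ltW d_gt0) // ?exprn_ege1 //.
  exact/d_le/full_completion.
have yE A : clique e A -> transfer e y A <= (beta + eps) * y A.
  move=> cA; have fA := full_completion cA.
  rewrite /transfer (bigID (meets A)) /= mulrDl lerD //.
    rewrite {2}/y mulrCA -fE // /transfer mulr_sumr.
    rewrite big_mkcond [leRHS]big_mkcond /=.
    apply: ler_sum => v _.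
    have [Av|_] := boolP (meets A v); last first.
      rewrite andbF; case: ifP => // _.
      rewrite mulr_ge0 ?exprn_ge0 ?(ltW M_gt0) //.
      exact/ltW/f_gt0/full_step.
    have vm : v \notin missing A by rewrite inE Av andbF.
    rewrite finset.in_setU (negbTE vm) orbF andbT; case: ifP => // _.
    by rewrite /y missing_step_meets // step_completion // missing_step_meets.
  have step_le v : ~~ meets A v ->
      y (step e A v) <= M ^+ #|missing A| * (X / M).
    move=> /missing_step_proper/proper_card lt_card; rewrite /y.
    have fstep := full_completion (clique_step e_sym v cA).
    apply: (@le_trans _ _ (M ^+ #|missing (step e A v)| * X)).
      by rewrite ler_wpM2l ?le_X // exprn_ge0 // ltW.
    rewrite mulrA [_ * X / M]mulrAC ler_wpM2r // ler_pdivlMr // -exprSr.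
    by rewrite ler_weXn2l.
  apply: (@le_trans _ _ (\sum_(v in V) M ^+ #|missing A| * (X / M))).
    rewrite big_mkcond /=; apply: ler_sum => v _.
    case: ifP => [/andP[_ /step_le //]|_].
    by rewrite mulr_ge0 ?divr_ge0 ?exprn_ge0 // ltW.
  rewrite sumr_const -[leLHS]mulr_natl /y mulrCA [leRHS]mulrCA ler_wpM2l //.
    by rewrite exprn_ge0 // ltW.
  rewrite mulrA ler_pdivrMr //; apply: le_trans leM _.
  by rewrite ler_pM2r // ler_pM2l // d_le.
exists (d^-1 * weighted_count 0 y).
  rewrite mulr_gt0 ?invr_gt0 // /weighted_count /= big_seq1.
  apply: lt_le_trans d_gt0 (y_ge _ _); exact: (clique_descents [::]).
move=> l; rewrite -weighted_count1.
apply: (@le_trans _ _ (weighted_count l (fun A => d^-1 * y A))).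
  apply: le_weighted_count => A cA.
  by rewrite mulrC ler_pdivlMr // mul1r y_ge.
rewrite weighted_countZ -mulrA ler_wpM2l ?invr_ge0 ?(ltW d_gt0) // mulrC.
by apply: weighted_count_le => //; rewrite addr_ge0 // ltW.
Qed.

Lemma geodesic_growth_rate_harmonic beta f : 0 < beta -> harmonic e beta f ->
  geodesic_growth_rate (@racg_gens V e) R = beta.
Proof.
move=> beta_gt0 hf; rewrite /geodesic_growth_rate.
under [X in limn_sup X]funext => l do rewrite num_geodesicsE //.
apply: limn_sup_root => //; first exact: geodesic_count_lower hf.
exact: geodesic_count_upper hf.
Qed.

End GeodesicCount.

(** * The growth rate is 1 or a Perron number *)

Theorem theoremB (R : realType) (V : finType) (e : rel V)
    (e_sym : symmetric e) (e_irr : irreflexive e)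
    (G_infinite : infinite_set [set: racg e]) :
  let beta := geodesic_growth_rate (@racg_gens V e) R in
  beta = 1%R \/ perron_number beta.
Proof.
move=> beta; rewrite /beta {beta}.
have [/existsP[b /existsP[a /existsP[c /and3P[ba bc ac]]]]|no_branch] := boolP
    [exists b, exists a, exists c, [&& nonadj e b a, nonadj e b c & a != c]].
  have [beta perron [f hf]] := perron_harmonic e_sym e_irr R ba bc ac.
  have beta_gt0 : (0 < beta)%R by case: perron => _ /(lt_trans ltr01).
  by right; rewrite (geodesic_growth_rate_harmonic e_sym e_irr beta_gt0 hf).
have nonadj_uniq b a c : nonadj e b a -> nonadj e b c -> a = c.
  move=> ba bc; apply/eqP; apply: contraNT no_branch => ac.
  by apply/existsP; exists b; apply/existsP; exists a; apply/existsP; exists c;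
    rewrite ba bc.
have hf := harmonic_matching e_sym e_irr R nonadj_uniq.
set k := #|_| in hf.
have k_gt0 : (0 < k)%N.
  rewrite card_gt0; apply/negP => /eqP rootsC.
  apply: G_infinite; apply: finite_racg_complete => // u v.
  have /andP[/cliqueP clique_roots _] := full_transversal_roots e_sym.
  apply: clique_roots;
    by rewrite -[transversal_roots e]finset.setCK rootsC !inE.
have kR_gt0 : (0 < k%:R :> R)%R by rewrite ltr0n.
rewrite (geodesic_growth_rate_harmonic e_sym e_irr kR_gt0 hf).
case: k k_gt0 {hf kR_gt0} => [//|[|k]] _; first by left.
by right; exact: perron_number_nat.
Qed.
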